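(* There exists a twisted quojection without infinite-dimensional Banach subspaces. That is, there exists a Fr\'echet space $F$ which is a quojection, which is not isomorphic to a countable product of Banach spaces, and which has no closed infinite-dimensional subspace that is isomorphic (as a topological vector space) to a Banach space.
   Context: A Fr\'echet space $F$ is called a quojection if there exist a sequence $\{F_n\}_{n=1}^\infty$ of Banach spaces and a sequence of linear continuous surjective maps $R_n:F_{n+1}\to F_n$ ($n\in\mathbb{N}$) such that $F$ is isomorphic to the projective limit of the system $\{R_n\}_{n=1}^\infty$. A quojection is called twisted if it is not isomorphic to a countable product of Banach spaces. *)

(* Defs.v *)
From HB Require Import structures.
From mathcomp Require Import all_boot all_order all_algebra.
From mathcomp Require Import all_classical all_reals all_analysis.
Set Implicit Arguments. Unset Strict Implicit. Unset Printing Implicit Defensive.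
Import Order.TTheory GRing.Theory Num.Theory.
Local Open Scope classical_set_scope.
Local Open Scope ring_scope.

Section Defs.
Variable R : realType.

(* A Frechet space: a (locally convex, by tvsType) Hausdorff topological vector
   space which is metrizable (countable base of neighbourhoods of 0) and complete. *)
Definition frechet (F : tvsType R) : Prop :=
  [/\ hausdorff_space F,
      (exists B : nat -> set F,
          (forall n, nbhs (0 : F) (B n)) /\
          (forall U, nbhs (0 : F) U -> exists n, B n `<=` U))
    & (forall G : set_system F, ProperFilter G -> @cauchy F G -> exists x : F, G --> x)].

(* F is isomorphic (as a TVS) to the projective limit of the spectrum
   R_n : B (n+1) -> B n, via the coordinate maps Q n : F -> B n.
   The induced map x |-> (Q n x)_n is a bijection onto the set of
   compatible sequences, continuous (each Q n continuous) and open onto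
   its image (the topology of F is the initial one w.r.t. the Q n, i.e.
   the one induced by the product topology). *)
Definition iso_projlim (F : tvsType R) (B : nat -> completeNormedModType R)
    (Rm : forall n, {linear B n.+1 -> B n}) : Prop :=
  exists Q : forall n, {linear F -> B n},
  [/\ (forall n x, Rm n (Q n.+1 x) = Q n x),
      (forall n, continuous (Q n)),
      (forall x y, (forall n, Q n x = Q n y) -> x = y),
      (forall y : forall n, B n, (forall n, Rm n (y n.+1) = y n) ->
          exists x, forall n, Q n x = y n)
    & (forall U : set F, nbhs (0 : F) U ->
          exists (s : seq nat) (V : forall n, set (B n)),
            (forall n, n \in s -> nbhs (0 : B n) (V n)) /\
            (forall x, (forall n, n \in s -> V n (Q n x)) -> U x))].

Definition quojection (F : tvsType R) : Prop :=
  frechet F /\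
  exists (B : nat -> completeNormedModType R)
         (Rm : forall n, {linear B n.+1 -> B n}),
    (forall n, continuous (Rm n)) /\
    (forall n (b : B n), exists c : B n.+1, Rm n c = b) /\
    @iso_projlim F B Rm.

Definition iso_countable_product (F : tvsType R) : Prop :=
  exists (I : countType) (B : I -> completeNormedModType R)
         (Q : forall i, {linear F -> B i}),
  [/\ (forall i, continuous (Q i)),
      (forall x y, (forall i, Q i x = Q i y) -> x = y),
      (forall y : forall i, B i, exists x, forall i, Q i x = y i)
    & (forall U : set F, nbhs (0 : F) U ->
          exists (s : seq I) (V : forall i, set (B i)),
            (forall i, i \in s -> nbhs (0 : B i) (V i)) /\
            (forall x, (forall i, i \in s -> V i (Q i x)) -> U x))].

Definition twisted_quojection (F : tvsType R) : Prop :=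
  quojection F /\ ~ iso_countable_product F.

Definition lin_subspace (F : lmodType R) (S : set F) : Prop :=
  [/\ S 0, (forall x y, S x -> S y -> S (x + y))
    & (forall (a : R) x, S x -> S (a *: x))].

Definition infinite_dim (F : lmodType R) (S : set F) : Prop :=
  forall n : nat, exists v : 'I_n -> F,
    (forall i, S (v i)) /\
    (forall c : 'I_n -> R, \sum_(i < n) c i *: v i = 0 -> forall i, c i = 0).

Definition iso_to_banach (F : tvsType R) (S : set F) : Prop :=
  exists (B : completeNormedModType R) (T : {linear B -> F}),
  [/\ injective T, T @` setT = S, continuous T
    & (forall U : set B, nbhs (0 : B) U ->
         exists W : set F, nbhs (0 : F) W /\ (forall b, W (T b) -> U b))].

Definition has_inf_dim_banach_subspace (F : tvsType R) : Prop :=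
  exists S : set F,
    [/\ lin_subspace S, closed S, infinite_dim S & iso_to_banach S].

End Defs.

(* Main.v *)
Require Import Defs.
From HB Require Import structures.
From mathcomp Require Import all_boot all_order all_algebra.
From mathcomp Require Import all_classical all_reals all_analysis.
From mathcomp Require Import ring lra.
Set Implicit Arguments. Unset Strict Implicit. Unset Printing Implicit Defensive.
Import Order.TTheory GRing.Theory Num.Theory.
Import numFieldNormedType.Exports.
Local Open Scope classical_set_scope.
Local Open Scope ring_scope.

(* The space is the projective limit of a tower of twisted sums of l_2 of
   Kalton-Peck type. Its elements are arrays z : nat -> nat -> R, and the n-th
   Banach space F_n consists of arrays with columns k < n. With the unipotent
   operator (T a) k = a k + a (k - 1) acting on rows, the norm of z in F_n is
   at most r iff, for all scales m and columns c,
     sum_j (2^- m_j |(T^m_j z_j) c_j| - r 4^- m_j) <= r.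
   Up to constants this says that each row has a scale m_j with
   |T^m_j z_j| <= r 2^- m_j and sum_j 4^- m_j bounded. The scales of an element
   of F_n let one choose an n-th column, so F_(n+1) -> F_n is onto. In F_1 the
   norm is that of l_2, and so it is on the kernel of each map F_(n+1) -> F_n.
   If z vanishes below column p, then column p of T^m z is u := z p, and column
   p + 1 is z (p + 1) + m u. A sum of 4^L disjoint blocks of size about 1 has
   size 2^L, that is, its scale drops by L, and z (p + 1) would have to change
   by L u; choosing signs, this contradicts linearity as soon as all such sums
   have norm O(2^L) in F_(p+2). An infinite-dimensional Banach subspace of the
   limit is normed by some F_n; taking n minimal it contains perturbations of
   such blocks, with p = n - 1. Finally, were the limit a product of Banach
   spaces, all factors would be finite-dimensional, but F_1 is not. *)

(** * Dyadic weights and the unipotent operator on rows *)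

Section Weights.
Variable R : realType.
Implicit Types (a b : nat -> R) (k l m n p q : nat) (r s C : R).

Definition wt m : R := 2^-1 ^+ m.

Lemma wt_gt0 m : 0 < wt m.
Proof. by rewrite exprn_gt0// invr_gt0. Qed.

Lemma wt_ge0 m : 0 <= wt m.
Proof. exact/ltW/wt_gt0. Qed.

Lemma wtS m : wt m = 2 * wt m.+1.
Proof. by rewrite /wt exprS mulrA divff ?mul1r. Qed.

Lemma wtD m q : wt (m + q) = wt m * wt q.
Proof. exact: exprD. Qed.

Lemma wtV q : 2 ^+ q * wt q = 1.
Proof. by rewrite /wt -exprMn divff// expr1n. Qed.

Lemma wt_le1 m : wt m <= 1.
Proof. by rewrite exprn_ile1// ?invr_ge0// invf_le1// ler1n. Qed.

Lemma wt_sqr_le m : wt m ^+ 2 <= wt m.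
Proof. by rewrite expr2 ler_piMl ?wt_le1 ?wt_ge0. Qed.

Lemma wt_mul_nat_le1 q : q%:R * wt q <= 1.
Proof.
rewrite -[leRHS](wtV q) ler_wpM2r ?wt_ge0// -natrX ler_nat.
exact/ltnW/ltn_expl.
Qed.

Lemma wt_small (e : R) : 0 < e -> exists m, wt m <= e.
Proof.
move=> e0; have [m] : exists m, e^-1 < m%:R by exists (Num.bound e^-1); apply: archi_boundP; rewrite invr_ge0 ltW.
move=> em; exists m; have := wt_mul_nat_le1 m.
have m0 : 0 < m%:R :> R by apply: lt_trans em; rewrite invr_gt0.
rewrite mulrC -ler_pdivlMr// mul1r => /le_trans; apply.
by rewrite -[e]invrK lef_pV2 ?posrE ?invr_gt0// ltW.
Qed.

Lemma sum_wtS J : \sum_(j < J) wt j.+1 <= 1.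
Proof.
suff -> : \sum_(j < J) wt j.+1 = 1 - wt J by rewrite gerBl wt_ge0.
elim: J => [|J IH]; first by rewrite big_ord0 /wt expr0 subrr.
by rewrite big_ord_recr/= IH (wtS J); lra.
Qed.

(** A Jordan block [1 + N], whose [m]-th power is [1 + m N + ...]. With [m] near [- log2 |u|] the
    second term is, up to sign, the Kalton-Peck expression [u log |u|]. *)
Definition shift a k : R := a k + (if k is k'.+1 then a k' else 0).

Fixpoint unshift a k : R := a k - (if k is k'.+1 then unshift a k' else 0).

Definition shiftn m a := iter m shift a.

Lemma shiftK : cancel shift unshift.
Proof.
move=> a; apply/funext; elim=> [|k IH]/=; first by rewrite /shift subr0 addr0.
by rewrite IH /shift addrK.
Qed.

Lemma shiftnD m q a : shiftn (m + q) a = shiftn m (shiftn q a).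
Proof. exact: iterD. Qed.

Lemma shiftnS m a : shiftn m.+1 a = shift (shiftn m a).
Proof. by []. Qed.

Lemma iter_unshiftK q : cancel (shiftn q) (iter q unshift).
Proof. by elim: q => // q IH a; rewrite shiftnS iterSr shiftK IH. Qed.

Lemma shiftn_add m a b k :
  shiftn m (fun i => a i + b i) k = shiftn m a k + shiftn m b k.
Proof.
elim: m k => // m IH [|k]; rewrite !shiftnS /shift !IH; first by rewrite !addr0.
by rewrite addrACA.
Qed.

Lemma shiftn_scale m (c : R) a k :
  shiftn m (fun i => c * a i) k = c * shiftn m a k.
Proof.
elim: m k => // m IH [|k]; rewrite !shiftnS /shift !IH; first by rewrite !addr0.
by rewrite mulrDr.
Qed.

Lemma shiftn0 m a k : (forall i, a i = 0) -> shiftn m a k = 0.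
Proof.
move=> a0; elim: m k => [|m IH] k; first exact: a0.
by rewrite shiftnS /shift IH; case: k => [|k]; rewrite ?IH addr0.
Qed.

(** The operator is lower triangular with unit diagonal, so column [n] enters position [n] of every
    power with coefficient 1. Truncation and lifting both rest on this. *)
Lemma shiftn_agree m n a b : (forall k, (k < n)%N -> a k = b k) ->
  (forall k, (k < n)%N -> shiftn m a k = shiftn m b k) /\
  shiftn m a n - shiftn m b n = a n - b n.
Proof.
move=> ab; elim: m => [|m [IH1 IH2]]; first by [].
split=> [k kn|]; rewrite !shiftnS /shift.
  by rewrite IH1//; case: k kn => // k kn; rewrite IH1// ltnW.
case: n ab IH1 IH2 => [|n] ab IH1 IH2; first by rewrite !addr0.
by rewrite (IH1 n)// opprD addrACA subrr addr0.
Qed.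

(** The binomial expansion of [(1 + N) ^ m], read up to the second column that can be nonzero. *)
Lemma shiftn_lead0 m p a : (forall k, (k < p)%N -> a k = 0) ->
  [/\ forall k, (k < p)%N -> shiftn m a k = 0, shiftn m a p = a p
    & shiftn m a p.+1 = a p.+1 + m%:R * a p].
Proof.
move=> a0; elim: m => [|m [IH1 IH2 IH3]]; first by split=> //; rewrite mul0r addr0.
split=> [k kp||]; rewrite !shiftnS /shift.
- by rewrite IH1//; case: k kp => [|k] kp; rewrite ?addr0// IH1 ?addr0// ltnW.
- by rewrite IH2; case: p a0 IH1 {IH2 IH3} => [|p] a0 IH1; rewrite ?addr0// IH1// addr0.
- by rewrite IH3 IH2 -natr1 mulrDl mul1r addrA.
Qed.

Lemma shift_bound n a C : (forall k, (k < n)%N -> `|a k| <= C) ->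
  forall k, (k < n)%N -> `|shift a k| <= 2 * C.
Proof.
move=> aC k kn; have C0 : 0 <= C := le_trans (normr_ge0 _) (aC k kn).
rewrite /shift (le_trans (ler_normD _ _))// mulrDl mul1r lerD ?aC//.
by case: k kn => [|k] kn; rewrite ?normr0// aC// ltnW.
Qed.

Lemma shiftn_bound n q a C : (forall k, (k < n)%N -> `|a k| <= C) ->
  forall k, (k < n)%N -> `|shiftn q a k| <= 2 ^+ q * C.
Proof.
move=> aC; elim: q => [|q IH] k kn; first by rewrite expr0 mul1r aC.
by rewrite shiftnS exprS -mulrA; apply: shift_bound kn.
Qed.

(** A Pascal recursion: the bounds at [(q, k + 1)] and [(q + 1, k)] add up to the one at
    [(q + 1, k + 1)]. The cost beyond [2 ^+ q] depends on the column alone, not on the number of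
    steps. *)
Lemma iter_unshift_bound n q a C : (forall k, (k < n)%N -> `|a k| <= C) ->
  forall k, (k < n)%N -> `|iter q unshift a k| <= 2 ^+ k * (2 ^+ q * C).
Proof.
move=> aC; elim: q => [|q IHq] k kn.
  have C0 : 0 <= C := le_trans (normr_ge0 _) (aC k kn).
  by rewrite expr0 mul1r (le_trans (aC _ kn))// ler_peMl// exprn_ege1// ler1n.
rewrite iterS; elim: k kn => [|k IHk] kn /=.
  rewrite subr0 (le_trans (IHq _ kn))// !expr0 !mul1r exprS -mulrA ler_peMl ?ler1n//.
  by rewrite mulr_ge0 ?exprn_ge0// (le_trans (normr_ge0 _) (aC _ kn)).
rewrite (le_trans (ler_normB _ _))//.
have := IHk (ltnW kn); have := IHq _ kn; rewrite !exprS.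
set x := 2 ^+ k; set y := 2 ^+ q; nra.
Qed.

End Weights.

(** * The balls of F_n, their description by scales, lifting, and the l_2 kernels *)

Section Balls.
Variable R : realType.
Local Notation arr := (nat -> nat -> R^o).
Local Notation wt := (wt R).
Implicit Types (z y : arr) (j k m n p q J : nat) (r s C : R).

(** For fixed [J], [P], [m], [c] the condition bounds by [r] a seminorm of [z]: the weighted sum
    divided by 1 plus the sum of the squared weights. Hence balls add and scale, and since each
    condition reads finitely many entries, they are closed under entrywise limits. *)
Definition inball n r z : Prop :=
  [/\ 0 <= r, forall j k, (n <= k)%N -> z j k = 0
    & forall J (P : pred nat) (m c : nat -> nat), (forall j, (c j < n)%N) ->
      \sum_(j < J | P j)
        (wt (m j) * `|shiftn (m j) (z j) (c j)| - r * wt (m j) ^+ 2) <= r].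

Lemma inball_le n r s z : r <= s -> inball n r z -> inball n s z.
Proof.
move=> rs [r0 z0 zr]; split=> // [|J P m c cn]; first exact: le_trans rs.
apply: (le_trans _ rs); apply: le_trans (zr J P m c cn); apply: ler_sum => j _.
by rewrite lerD2l lerN2 ler_wpM2r// exprn_ge0// wt_ge0.
Qed.

Lemma inball00 n : inball n 0 0.
Proof.
split=> // J P m c cn; rewrite big1// => j _; rewrite mul0r subr0.
by rewrite shiftn0// normr0 mulr0.
Qed.

Lemma inballD n r s z y : inball n r z -> inball n s y -> inball n (r + s) (z + y).
Proof.
move=> [r0 z0 zr] [s0 y0 ys]; split=> [|j k nk|J P m c cn].
- exact: addr_ge0.
- by rewrite !fctE z0// y0// addr0.
- apply: le_trans (lerD (zr J P m c cn) (ys J P m c cn)).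
  rewrite -big_split/=; apply: ler_sum => j _.
  rewrite (shiftn_add (m j) (z j) (y j)).
  have := ler_normD (shiftn (m j) (z j) (c j)) (shiftn (m j) (y j) (c j)).
  move=> /(ler_wpM2l (wt_ge0 R (m j))); lra.
Qed.

Lemma inballZ n (a : R) r z : inball n r z -> inball n (`|a| * r) (a *: z).
Proof.
move=> [r0 z0 zr]; split=> [|j k nk|J P m c cn].
- exact: mulr_ge0.
- by rewrite !fctE z0// scaler0.
- apply: le_trans (ler_wpM2l (normr_ge0 a) (zr J P m c cn)).
  rewrite mulr_sumr; apply: ler_sum => j _.
  rewrite (shiftn_scale (m j) a (z j)) normrM; lra.
Qed.

Lemma inballN n r z : inball n r z -> inball n r (- z).
Proof. by move=> /(@inballZ _ (-1)); rewrite normrN1 mul1r scaleN1r. Qed.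

Lemma inballB n r s z y : inball n r z -> inball n s y -> inball n (r + s) (z - y).
Proof. by move=> zr /inballN; exact: inballD. Qed.

Lemma inball_closed n r z : (forall s, r < s -> inball n s z) -> inball n r z.
Proof.
move=> zs; split=> [|j k|J P m c cn].
- by apply/ler_addgt0Pr => e e0; have [] := zs (r + e); rewrite ?ltrDl.
- by case: (zs (r + 1)); rewrite ?ltrDl// => _ + _; apply.
- set S := \sum_(j < J | P j) wt (m j) ^+ 2.
  have S0 : 0 <= S by apply: sumr_ge0 => j _; rewrite exprn_ge0// wt_ge0.
  apply/ler_addgt0Pr => e e0.
  (* Raising [r] by [d] relaxes the condition by [d * (1 + S)], which is made equal to [e]. *)
  have d0 : 0 < e / (1 + S) by rewrite divr_gt0// ltr_wpDr.
  have [|_ _ /(_ J P m c cn)] := zs (r + e / (1 + S)); first by rewrite ltrDl.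
  have -> : \sum_(j < J | P j) (wt (m j) * `|shiftn (m j) (z j) (c j)| -
      (r + e / (1 + S)) * wt (m j) ^+ 2) =
      \sum_(j < J | P j) (wt (m j) * `|shiftn (m j) (z j) (c j)| -
        r * wt (m j) ^+ 2) - e / (1 + S) * S.
    by rewrite /S mulr_sumr -sumrB; apply: eq_bigr => j _; ring.
  rewrite lerBlDr => /le_trans; apply.
  rewrite -addrA lerD2l -[X in X + _]mulr1 -mulrDr mulfVK// gt_eqF//.
  by rewrite ltr_wpDr.
Qed.

(** A single row tested at scale 0 contributes [|z j k| - r], which is at most [r]. *)
Lemma inball_entry n r z j k : inball n r z -> `|z j k| <= 2 * r.
Proof.
move=> [r0 z0 zr]; have [kn|nk] := ltnP k n; last by rewrite z0// normr0 mulr_ge0.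
have := zr j.+1 (pred1 j) (fun=> 0%N) (fun=> k) (fun=> kn).
rewrite (eq_bigl (fun i : 'I_j.+1 => i == ord_max)) => [|i]/=; last by rewrite -val_eqE.
by rewrite big_pred1_eq/= /wt expr0 expr1n mul1r mulr1 lerBlDr -mulr2n mulr_natl.
Qed.

Lemma inball0_eq0 n z : inball n 0 z -> z = 0.
Proof.
move=> z0; apply/funext => j; apply/funext => k.
by have := inball_entry j k z0; rewrite mulr0 normr_le0 => /eqP.
Qed.

(** The row predicate [P] of the ball condition absorbs [Q], and zeroed rows contribute nonpositive
    terms. *)
Lemma inball_restrict n r z (Q : pred nat) : inball n r z ->
  inball n r (fun j k => if Q j then z j k else 0).
Proof.
move=> [r0 z0 zr]; split=> // [j k nk|J P m c cn]; first by case: ifP; rewrite ?z0.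
apply: le_trans (zr J (fun j => P j && Q j) m c cn).
rewrite (bigID (fun j : 'I_J => Q j))/= -[leRHS]addr0; apply: lerD.
  apply: ler_sum => j /andP[_ Qj].
  suff -> : (fun k => if Q j then z j k else 0) = z j by [].
  by apply/funext => k; rewrite Qj.
apply: sumr_le0 => j /andP[_ /negbTE Qj].
rewrite shiftn0 => [|k]; last by rewrite Qj.
by rewrite normr0 mulr0 sub0r oppr_le0 mulr_ge0// exprn_ge0// wt_ge0.
Qed.

Definition cut n z : arr := fun j k => if (k < n)%N then z j k else 0.

Lemma inball_cut n r z : inball n.+1 r z -> inball n r (cut n z).
Proof.
move=> [r0 z0 zr]; split=> // [j k nk|J P m c cn]; first by rewrite /cut ltnNge nk.
apply: le_trans (zr J P m c (fun j => leqW (cn j))).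
apply: ler_sum => j _; rewrite lerD2r.
have [|H _] := @shiftn_agree R (m j) n (cut n z j) (z j); last by rewrite H.
by move=> k kn; rewrite /cut kn.
Qed.

(* The scale [m j] is the position where the [j]-th row, read at scale [2 ^- m],
   first becomes large; testing the ball condition there bounds the sum. *)
Lemma inball_scales n r z : 0 < r -> inball n r z ->
  exists m : nat -> nat,
    (forall j k, (k < n)%N -> `|shiftn (m j) (z j) k| <= 8 * r * wt (m j)) /\
    (forall J, \sum_(j < J) wt (m j) ^+ 2 <= 2).
Proof.
move=> r0 zr; have [_ z0 zsum] := zr.
pose big j m := [exists k : 'I_n, 2 * r * wt m <= `|shiftn m (z j) k|].
have H j : exists m, (forall k, (k < n)%N -> `|shiftn m (z j) k| <= 8 * r * wt m) /\
    (big j m \/ wt m ^+ 2 <= wt j.+1).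
  have [ex|nex] := pselect (exists m, big j m); last first.
    (* A row that is never large vanishes: its first nonzero entry is the same at all scales, while
       the thresholds tend to 0. The scale [j.+1] only keeps the weights summable. *)
    exists j.+1; split; last by right; exact: wt_sqr_le.
    suff z00 k : (k < n)%N -> z j k = 0.
      have [H _] := @shiftn_agree R j.+1 n (z j) (fun=> 0) z00.
      by move=> k kn; rewrite H// shiftn0// normr0 !mulr_ge0 ?wt_ge0// ltW.
    elim/ltn_ind: k => k IH kn; apply/eqP; apply: contra_notT nex => zk.
    have [|m wm] := @wt_small R (`|z j k| / (2 * r)).
      by rewrite divr_gt0 ?normr_gt0// mulr_gt0.
    have [i ik|_ sk _] := @shiftn_lead0 R m k (z j).
      by apply: IH => //; exact: ltn_trans kn.
    exists m; apply/existsP; exists (Ordinal kn).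
    by rewrite sk mulrC -ler_pdivlMr ?mulr_gt0.
  (* Just before the first large scale the row is below the threshold [2 * r * wt m]; one more
     [shift] at most doubles it while the weight halves, whence the factor 8. *)
  exists (ex_minn ex); case: ex_minnP => m bm mmin; split; last by left.
  case: m bm mmin => [|m] bm mmin k kn.
    rewrite (le_trans (inball_entry j k zr))// /wt expr0 mulr1 ler_wpM2r ?ltW//.
    by rewrite ltr_nat.
  rewrite shiftnS (_ : 8 * r * wt m.+1 = 2 * (2 * r * wt m)); last by rewrite (wtS R m); ring.
  apply: shift_bound kn => i ni; apply: contraT; rewrite -ltNge => lt_i.
  have /mmin : big j m by apply/existsP; exists (Ordinal ni); rewrite ltW.
  by rewrite ltnn.
have {H}[m Hm] := choice H; exists m; split=> [j|J]; first by case: (Hm j).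
rewrite (bigID (fun j : 'I_J => big j (m j)))/= (natrD _ 1 1); apply: lerD; last first.
  rewrite (le_trans _ (@sum_wtS R J))//.
  rewrite [leRHS](bigID (fun j : 'I_J => big j (m j)))/= ler_wpDl//.
    by apply: sumr_ge0 => j _; exact: wt_ge0.
  by apply: ler_sum => j /negbTE nb; have [_ [|//]] := Hm j; rewrite nb.
have [n0|n0] := posnP n.
  by rewrite big_pred0// => j; apply/negbTE/existsPn; move: n0 => -> [].
have Hc j : exists c, (c < n)%N /\ (big j (m j) -> 2 * r * wt (m j) <= `|shiftn (m j) (z j) c|).
  have [/existsP[c cb]|nb] := boolP (big j (m j)); first by exists c.
  by exists 0%N.
have {Hc}[c Hc] := choice Hc.
have := zsum J (fun j => big j (m j)) m c (fun j => (Hc j).1).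
move=> H; rewrite -(ler_pM2l r0) mulr1 (le_trans _ H)// mulr_sumr.
apply: ler_sum => j bj; have := (Hc j).2 bj.
move=> /(ler_wpM2l (wt_ge0 R (m j))); lra.
Qed.

(** Converse of [inball_scales]. Passing from scale [m j] up to a test scale at most doubles the row
    at each step, which the weights offset, and leaves the summable [wt (m j) ^+ 2]. Passing down
    costs a further [2 ^+ c j], the source of [2 ^+ n], and leaves a multiple of [wt (l j) ^+ 2],
    absorbed by the subtracted term. *)
Lemma scales_inball n z C s (m : nat -> nat) : 0 <= C -> 1 <= s ->
  (forall j k, (n <= k)%N -> z j k = 0) ->
  (forall j k, (k < n)%N -> `|shiftn (m j) (z j) k| <= C * wt (m j)) ->
  (forall J, \sum_(j < J) wt (m j) ^+ 2 <= s) ->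
  inball n (2 ^+ n * C * s) z.
Proof.
move=> C0 s1 z0 zC ms; set A := 2 ^+ n * C.
have A0 : 0 <= A by rewrite mulr_ge0// exprn_ge0.
have CA : C <= A by rewrite ler_peMl// exprn_ege1// ler1n.
split=> // [|J P l c cn]; first by rewrite mulr_ge0// (le_trans _ s1).
apply: (@le_trans _ _ (A * \sum_(j < J | P j) wt (m j) ^+ 2)); last first.
  apply: ler_wpM2l => //; apply: le_trans (ms J).
  rewrite [leRHS](bigID (fun j : 'I_J => P j))/= lerDl.
  by apply: sumr_ge0 => j _; rewrite exprn_ge0// wt_ge0.
rewrite mulr_sumr; apply: ler_sum => j _; rewrite lerBlDr.
suff H : wt (l j) * `|shiftn (l j) (z j) (c j)| <= A * (wt (m j) ^+ 2 + wt (l j) ^+ 2).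
  apply: le_trans H _; rewrite mulrDr lerD2l ler_wpM2r ?exprn_ge0 ?wt_ge0//.
  by rewrite ler_peMr.
have [lm|ml] := leqP (m j) (l j).
  have -> : l j = (l j - m j + m j)%N by rewrite subnK.
  set q := (l j - m j)%N; rewrite shiftnD wtD.
  have := shiftn_bound q (zC j) (cn j).
  move=> /(ler_wpM2l (mulr_ge0 (wt_ge0 R q) (wt_ge0 R (m j)))) /le_trans; apply.
  have -> : wt q * wt (m j) * (2 ^+ q * (C * wt (m j))) =
    (2 ^+ q * wt q) * (C * wt (m j) ^+ 2) by ring.
  rewrite wtV mul1r mulrDr ler_wpDr ?mulr_ge0 ?exprn_ge0 ?mulr_ge0 ?wt_ge0//.
  by rewrite ler_wpM2r// exprn_ge0// wt_ge0.
have mE : m j = (m j - l j + l j)%N by rewrite subnK// ltnW.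
set q := (m j - l j)%N in mE.
have -> : shiftn (l j) (z j) = iter q (@unshift R) (shiftn (m j) (z j)).
  by rewrite [in RHS]mE shiftnD iter_unshiftK.
have := iter_unshift_bound q (zC j) (cn j).
move=> /(ler_wpM2l (wt_ge0 R (l j))) /le_trans; apply.
rewrite [in leLHS]mE wtD.
have -> : wt (l j) * (2 ^+ c j * (2 ^+ q * (C * (wt q * wt (l j))))) =
    (2 ^+ q * wt q) * (2 ^+ c j * C * wt (l j) ^+ 2) by ring.
rewrite wtV mul1r mulrDr ler_wpDl ?mulr_ge0 ?exprn_ge0 ?wt_ge0//.
rewrite ler_wpM2r ?exprn_ge0 ?wt_ge0// ler_wpM2r// ler_weXn2l ?ler1n//.
exact: ltnW.
Qed.

(** Makes F_(n+1) -> F_n onto, with norm control: the new column is chosen so that column [n] of the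
    [m j]-th power vanishes in each row. Old scales then still serve, and [scales_inball] with
    [C = 8 * r], [s = 2] gives the constant. *)
Lemma inball_lift n r z : 0 < r -> inball n r z -> exists y,
  (forall j k, k != n -> y j k = z j k) /\ inball n.+1 (2 ^+ (n + 5) * r) y.
Proof.
move=> r0 zr; have [m [mz ms]] := inball_scales r0 zr; have [_ z0 _] := zr.
pose y : arr := fun j k => if k == n then - shiftn (m j) (z j) n else z j k.
have yz j k : k != n -> y j k = z j k by move=> /negbTE kn; rewrite /y kn.
exists y; split=> //.
have -> : 2 ^+ (n + 5) * r = 2 ^+ n.+1 * (8 * r) * 2 by rewrite exprD (exprS _ n); ring.
apply: (@scales_inball _ _ _ _ m) => //.
- by rewrite mulr_ge0// ltW.
- by rewrite ler1n.
- by move=> j k nk; rewrite yz ?gtn_eqF// z0// ltnW.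
- move=> j k; have [|H1 H2] := @shiftn_agree R (m j) n (y j) (z j).
    by move=> i ni; rewrite yz// ltn_eqF.
  rewrite ltnS leq_eqVlt => /predU1P[->|kn]; last by rewrite H1// mz.
  move: H2; rewrite (z0 j n)// subr0 {2}/y eqxx => /eqP.
  by rewrite subr_eq addNr => /eqP ->; rewrite normr0 !mulr_ge0 ?wt_ge0// ltW.
Qed.

(** The bounded arrays of this form make up the kernel of F_(p+1) -> F_p. *)
Definition lead p (u : nat -> R) : arr := fun j k => if k == p then u j else 0.

(** Powers of [shift] fix the leading column, so the scale of row [j] only has to match the size of
    [u j / s]. With [inball_lead_coord] this identifies the kernel norm with that of l_2, up to
    constants. *)
Lemma inball_lead p (u : nat -> R) s : 0 < s ->
  (forall J, \sum_(j < J) u j ^+ 2 <= s ^+ 2) ->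
  inball p.+1 (2 ^+ p.+1 * s * 5) (lead p u).
Proof.
move=> s0 us.
have us1 j : `|u j| <= s.
  have := us j.+1; rewrite big_ord_recr/= => H.
  rewrite -(@ler_pXn2r _ 2) ?nnegrE ?(ltW s0)// real_normK ?num_real//.
  by apply: le_trans H; rewrite lerDr sumr_ge0// => i _; rewrite sqr_ge0.
have H j : exists m, `|u j| <= s * wt m /\
    (wt m ^+ 2 <= 4 * (u j ^+ 2 / s ^+ 2) + wt j.+1).
  have [->|u0] := eqVneq (u j) 0.
    exists j.+1; rewrite normr0 mulr_ge0 ?wt_ge0 ?(ltW s0)//; split=> //.
    by rewrite expr0n mul0r mulr0 add0r wt_sqr_le.
  (* The least such [m] satisfies [|u j| <= s * wt m <= 2 * |u j|]. The 4 is the square of this 2;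
     adding the summable weights used for zero entries gives the 5 of the statement. *)
  have ex : exists m, s * wt m.+1 <= `|u j|.
    have [|m wm] := @wt_small R (`|u j| / s); first by rewrite divr_gt0 ?normr_gt0.
    exists m; rewrite mulrC -ler_pdivlMr//; apply: le_trans wm.
    by rewrite (wtS R m) ler_peMl ?wt_ge0// ler1n.
  exists (ex_minn ex); case: ex_minnP => m Hm mmin; split.
    case: m Hm mmin => [|m] Hm mmin; first by rewrite /wt expr0 mulr1.
    by apply: contraT; rewrite -ltNge => /ltW/mmin; rewrite ltnn.
  rewrite ler_wpDr ?wt_ge0// (wtS R m) exprMn -natrX ler_wpM2l//.
  rewrite ler_pdivlMr ?exprn_gt0// -exprMn mulrC -(real_normK (num_real (u j))).
  by rewrite ler_pXn2r ?nnegrE ?mulr_ge0 ?wt_ge0 ?(ltW s0)//.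
have {H}[m Hm] := choice H.
apply: (@scales_inball _ _ _ _ m) => [|||j k|J].
- exact: ltW.
- by rewrite ler1n.
- by move=> j k pk; rewrite /lead gtn_eqF.
- have [|H1 H2 _] := @shiftn_lead0 R (m j) p (lead p u j).
    by move=> i ip; rewrite /lead ltn_eqF.
  rewrite ltnS leq_eqVlt => /predU1P[->|kp]; last first.
    by rewrite H1// normr0 mulr_ge0 ?wt_ge0// ltW.
  by rewrite H2 /lead eqxx (Hm j).1.
- apply: (@le_trans _ _ (\sum_(j < J) (4 * (u j ^+ 2 / s ^+ 2) + wt j.+1))).
    by apply: ler_sum => j _; exact: (Hm j).2.
  rewrite big_split/= -mulr_sumr -mulr_suml (natrD _ 4 1); apply: lerD; last exact: sum_wtS.
  rewrite ler_piMr// ler_pdivrMr ?exprn_gt0// mul1r. exact: us.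
Qed.

(** The leading column is the same at every scale, so [inball_scales] bounds it by
    [8 * r * wt (m j)]; squaring and summing gives [64 * 2]. *)
Lemma inball_lead_coord p r z J : 0 < r -> inball p.+1 r z ->
  (forall j k, (k < p)%N -> z j k = 0) ->
  \sum_(j < J) z j p ^+ 2 <= 128 * r ^+ 2.
Proof.
move=> r0 zr z0; have [m [mz ms]] := inball_scales r0 zr.
apply: (@le_trans _ _ (64 * r ^+ 2 * \sum_(j < J) wt (m j) ^+ 2)).
  rewrite mulr_sumr; apply: ler_sum => j _.
  have [_ sp _] := shiftn_lead0 (m j) (z0 j).
  have := mz j p (ltnSn p); rewrite sp => zj.
  rewrite -(real_normK (num_real (z j p))).
  have -> : 64 * r ^+ 2 * wt (m j) ^+ 2 = (8 * r * wt (m j)) ^+ 2 by ring.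
  by rewrite ler_pXn2r ?nnegrE ?mulr_ge0 ?wt_ge0 ?(ltW r0)//.
have := ms J; have := exprn_ge0 2 (ltW r0).
set S := \sum_(j < J) _; nra.
Qed.

End Balls.

(** * Signed sums of disjoint blocks *)

Section KaltonPeck.
Variable R : realType.
Local Notation arr := (nat -> nat -> R^o).
Local Notation wt := (wt R).

Definition signs (e : nat -> R) := forall a, e a = 1 \/ e a = -1.

Lemma signs_sqr e a : signs e -> e a ^+ 2 = 1.
Proof. by move=> /(_ a)[] ->; rewrite ?sqrrN expr1n. Qed.

Lemma signs_norm e a : signs e -> `|e a| = 1.
Proof. by move=> /(_ a)[] ->; rewrite ?normrN normr1. Qed.

(** Each sign is chosen to make the inner product with the sum so far nonnegative, so squared norms
    in Euclidean [J]-space at least add. *)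
Lemma exists_signs N J (b : nat -> nat -> R) : exists2 e, signs e &
  \sum_(a < N) \sum_(j < J) b a j ^+ 2 <=
  \sum_(j < J) (\sum_(a < N) e a * b a j) ^+ 2.
Proof.
elim: N => [|N [e es IH]].
  exists (fun=> 1); first by left.
  by rewrite big_ord0 sumr_ge0// => j _; rewrite sqr_ge0.
pose X j := \sum_(a < N) e a * b a j.
pose t : R := if 0 <= \sum_(j < J) X j * b N j then 1 else -1.
exists (fun a => if (a < N)%N then e a else t).
  by move=> a; case: ifP => _; [exact: es|rewrite /t; case: ifP; [left|right]].
rewrite big_ord_recr/=.
have -> : \sum_(j < J) (\sum_(a < N.+1) (if (a < N)%N then e a else t) * b a j) ^+ 2 =
    \sum_(j < J) X j ^+ 2 + \sum_(j < J) b N j ^+ 2 + t * 2 * \sum_(j < J) X j * b N j.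
  rewrite mulr_sumr -!big_split/=; apply: eq_bigr => j _.
  have -> : \sum_(a < N.+1) (if (a < N)%N then e a else t) * b a j = X j + t * b N j.
    rewrite big_ord_recr/= ltnn; congr (_ + _).
    by apply: eq_bigr => a _; rewrite ltn_ord.
  have : t ^+ 2 = 1 by rewrite /t; case: ifP => _; rewrite ?sqrrN expr1n.
  by move=> t2; rewrite sqrrD exprMn t2; ring.
apply: ler_wpDr; last by rewrite lerD2r.
rewrite /t; case: (lerP 0 (\sum_(j < J) X j * b N j)) => h; nra.
Qed.

(** If [q] is the gap between [m + L] and [M], the smaller of the two bounds on [u] is [wt q] times
    the larger, and [q%:R * wt q <= 1] pays for the factor [q]. *)
Lemma scale_gap (u B : R) m M L : 0 <= B -> `|u| <= B * wt m ->
  `|u| <= B * (2 ^+ L * wt M) ->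
  `|(m%:R + L%:R - M%:R) * u| <= B * (wt m + 2 ^+ L * wt M).
Proof.
move=> B0 um uM; rewrite mulrDr normrM.
have [ML|ML] := leqP M (m + L).
  have mE : (m + L = M + (m + L - M))%N by rewrite subnKC.
  set q := (m + L - M)%N in mE.
  have -> : m%:R + L%:R - M%:R = q%:R :> R.
    by rewrite -natrD mE natrD addrAC subrr add0r.
  rewrite normr_nat ler_wpDl ?mulr_ge0 ?wt_ge0//.
  have wE : wt m = 2 ^+ L * wt M * wt q.
    by rewrite -mulrA -wtD -mE wtD mulrCA wtV mulr1.
  have := ler_wpM2l (ler0n R q) um; move=> /le_trans; apply.
  have := ler_wpM2l (mulr_ge0 B0 (mulr_ge0 (exprn_ge0 L (ler0n R 2)) (wt_ge0 R M))) (wt_mul_nat_le1 R q).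
  rewrite wE; lra.
have mE : (M = m + L + (M - (m + L)))%N by rewrite subnKC// ltnW.
set q := (M - (m + L))%N in mE.
have -> : m%:R + L%:R - M%:R = - q%:R :> R.
  by rewrite mE !natrD; lra.
rewrite normrN normr_nat ler_wpDr ?mulr_ge0 ?exprn_ge0 ?wt_ge0//.
have wE : 2 ^+ L * wt M = wt m * wt q.
  by rewrite mE !wtD mulrA (mulrC (wt m)) mulrA wtV mul1r.
have := ler_wpM2l (ler0n R q) uM; move=> /le_trans; apply.
have := ler_wpM2l (mulr_ge0 B0 (wt_ge0 R m)) (wt_mul_nat_le1 R q).
rewrite wE; lra.
Qed.

(* The Kalton-Peck computation: on vectors with disjoint leading coordinates the
   next coordinate of a sum of [4 ^ L] terms is off by [L] times the leading
   coordinate, since the sum lives [L] dyadic scales below its terms. *)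
Lemma disjoint_sum_bound p L C J (z : nat -> arr) : 0 < C ->
  (forall a j k, (k < p)%N -> z a j k = 0) ->
  (forall a b j, a != b -> z a j p = 0 \/ z b j p = 0) ->
  (forall a, inball p.+2 C (z a)) ->
  (forall e, signs e -> inball p.+2 (C * 2 ^+ L) (\sum_(a < 4 ^ L) e a *: z a)) ->
  exists2 a, (a < 4 ^ L)%N &
    L%:R ^+ 2 * \sum_(j < J) z a j p ^+ 2 <= 2816 * C ^+ 2.
Proof.
have four : 4 ^+ L = (2 ^+ L) ^+ 2 :> R.
  by rewrite -exprM mulnC exprM (_ : 2 ^+ 2 = 4)//; ring.
move=> C0 zlead zdisj zC zsum; set N := (4 ^ L)%N.
have [m Hm] := choice (fun a => inball_scales C0 (zC a)).
(* Column [p.+1] of the row read at scale [m a j + L]. At scale [m a j] it is small, so what remains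
   is essentially [L] times the leading entry. *)
pose b a j : R := z a j p.+1 + ((m a j)%:R + L%:R) * z a j p.
have [e es be] := exists_signs N J b.
have [|M [M1 M2]] := inball_scales _ (zsum e es); first by rewrite mulr_gt0// exprn_gt0.
set Z := \sum_(a < N) e a *: z a in M1.
have ZE j k : Z j k = \sum_(a < N) e a * z a j k by rewrite /Z !fct_sumE.
have Zlead j k : (k < p)%N -> Z j k = 0.
  by move=> kp; rewrite ZE big1// => a _; rewrite zlead// mulr0.
have um a j : `|z a j p| <= 8 * C * wt (m a j).
  have [H _] := Hm a; have := H j p (leqW (ltnSn p)).
  by have [_ -> _] := shiftn_lead0 (m a j) (zlead a j).
have vm a j : `|z a j p.+1 + (m a j)%:R * z a j p| <= 8 * C * wt (m a j).
  have [H _] := Hm a; have := H j p.+1 (ltnSn p.+1).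
  by have [_ _ ->] := shiftn_lead0 (m a j) (zlead a j).
have UM j : `|Z j p| <= 8 * C * (2 ^+ L * wt (M j)).
  have := M1 j p (leqW (ltnSn p)).
  by have [_ -> _] := shiftn_lead0 (M j) (Zlead j); rewrite !mulrA.
have VM j : `|Z j p.+1 + (M j)%:R * Z j p| <= 8 * C * (2 ^+ L * wt (M j)).
  have := M1 j p.+1 (ltnSn p.+1).
  by have [_ _ ->] := shiftn_lead0 (M j) (Zlead j); rewrite !mulrA.
(* The error of reading row [j] of the sum at its own scale [M j] rather than at [m a j + L]. By
   disjointness only one [a] contributes, and [scale_gap] bounds it. *)
pose E j := \sum_(a < N) e a * (((m a j)%:R + L%:R - (M j)%:R) * z a j p).
have Eb j : E j ^+ 2 <= 128 * C ^+ 2 *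
    (\sum_(a < N) wt (m a j) ^+ 2 + 4 ^+ L * wt (M j) ^+ 2).
  have S0 (P : pred 'I_N) : 0 <= \sum_(a < N | P a) wt (m a j) ^+ 2.
    by apply: sumr_ge0 => a _; rewrite exprn_ge0// wt_ge0.
  have [/existsP[a0 ua0]|/existsPn ua] := boolP [exists a : 'I_N, z a j p != 0]; last first.
    rewrite /E big1 => [|a _]; last by have := ua a; rewrite negbK => /eqP ->; rewrite !mulr0.
    by rewrite expr0n/= !mulr_ge0// ?addr_ge0// ?mulr_ge0// ?exprn_ge0// ?wt_ge0// ltW.
  have ub a : a != a0 -> z a j p = 0.
    by move=> aa0; have [//|] := zdisj a a0 j aa0; move/eqP: ua0.
  have Ua0 : `|z a0 j p| <= 8 * C * (2 ^+ L * wt (M j)).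
    apply: le_trans (UM j); rewrite ZE (bigD1 a0)//= big1 => [|a aa0]; last by rewrite ub ?mulr0.
    by rewrite addr0 normrM (signs_norm a0 es) mul1r.
  have EE : `|E j| <= 8 * C * (wt (m a0 j) + 2 ^+ L * wt (M j)).
    rewrite /E (bigD1 a0)//= big1 => [|a aa0]; last by rewrite ub ?mulr0.
    rewrite addr0 normrM (signs_norm a0 es) mul1r scale_gap//.
    by rewrite mulr_ge0// ltW.
  have {}EE : E j ^+ 2 <= (8 * C * (wt (m a0 j) + 2 ^+ L * wt (M j))) ^+ 2.
    rewrite -(real_normK (num_real (E j))) ler_pXn2r ?nnegrE//.
    exact: le_trans EE.
  apply: le_trans EE _.
  rewrite (bigD1 a0)//= four.
  have := S0 (fun a => a != a0); set S := \sum_(a < N | _) _ => S0'.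
  set x := wt (m a0 j); set y := 2 ^+ L; set v := wt (M j).
  have : 0 <= C ^+ 2 * (x - y * v) ^+ 2 by rewrite mulr_ge0// sqr_ge0.
  have : 0 <= C ^+ 2 * S by rewrite mulr_ge0// sqr_ge0.
  lra.
have bE j : \sum_(a < N) e a * b a j = (Z j p.+1 + (M j)%:R * Z j p) + E j.
  rewrite !ZE mulr_sumr -!big_split/=; apply: eq_bigr => a _.
  by rewrite /b; ring.
(* The chosen signs turn the bound for one signed sum into a bound for the total of the squares,
   with [1280 = 384 * 2 + 256 * 2] per term. *)
have total : \sum_(a < N) \sum_(j < J) b a j ^+ 2 <= \sum_(a < N) 1280 * C ^+ 2.
  apply: le_trans be _; rewrite [leRHS]sumr_const card_ord -[_ *+ N]mulr_natl.
  apply: (@le_trans _ _ (\sum_(j < J) (384 * C ^+ 2 * 4 ^+ L * wt (M j) ^+ 2 +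
      256 * C ^+ 2 * \sum_(a < N) wt (m a j) ^+ 2))).
    apply: ler_sum => j _; rewrite bE.
    have {}VMj : (Z j p.+1 + (M j)%:R * Z j p) ^+ 2 <= (8 * C * (2 ^+ L * wt (M j))) ^+ 2.
      rewrite -(real_normK (num_real (Z j p.+1 + _))) ler_pXn2r ?nnegrE//.
      exact: le_trans (VM j).
    have Ej := Eb j; move: VMj Ej; rewrite four.
    set X := Z j p.+1 + _; have : 0 <= (X - E j) ^+ 2 by rewrite sqr_ge0.
    lra.
  rewrite big_split/= -!mulr_sumr exchange_big/=.
  have S1 := M2 J.
  have S2 : \sum_(a < N) \sum_(j < J) wt (m a j) ^+ 2 <= N%:R * 2.
    rewrite -[N in leRHS]card_ord mulr_natl -sumr_const; apply: ler_sum => a _.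
    by have [_] := Hm a; apply.
  have NE : N%:R = 4 ^+ L :> R by rewrite /N natrX.
  rewrite NE; rewrite NE in S2.
  have CN : 0 <= C ^+ 2 * 4 ^+ L by rewrite mulr_ge0// ?exprn_ge0// ltW.
  have := ler_wpM2l CN S1; have := ler_wpM2l (exprn_ge0 2 (ltW C0)) S2.
  lra.
have [a ba] : exists a : 'I_N, \sum_(j < J) b a j ^+ 2 <= 1280 * C ^+ 2.
  apply/existsP; rewrite -[X in is_true X]negbK negb_exists.
  apply/negP => /forallP H.
  have N0 : (0 < N)%N by rewrite expn_gt0.
  move: total; apply/negP; rewrite -ltNge.
  by apply: ltr_sum => [|a _]; [apply/hasP; exists (Ordinal N0); rewrite ?mem_index_enum|rewrite ltNge H].
exists a => //.
have : \sum_(j < J) (z a j p.+1 + (m a j)%:R * z a j p) ^+ 2 <= 128 * C ^+ 2.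
  apply: (@le_trans _ _ (64 * C ^+ 2 * \sum_(j < J) wt (m a j) ^+ 2)).
    rewrite mulr_sumr; apply: ler_sum => j _.
    rewrite -(real_normK (num_real (z a j p.+1 + _))).
    have -> : 64 * C ^+ 2 * wt (m a j) ^+ 2 = (8 * C * wt (m a j)) ^+ 2 by ring.
    rewrite ler_pXn2r ?nnegrE//; exact: le_trans (vm a j).
  have [_ /(_ J)] := Hm a; have := exprn_ge0 2 (ltW C0); set S := \sum_(j < J) _; nra.
(* [L] times the leading entry is the difference of column [p.+1] at scales [m a j + L] and [m a j];
   finally [2816 = 2 * 1280 + 2 * 128]. *)
have : L%:R ^+ 2 * \sum_(j < J) z a j p ^+ 2 <=
    2 * \sum_(j < J) b a j ^+ 2 +
    2 * \sum_(j < J) (z a j p.+1 + (m a j)%:R * z a j p) ^+ 2.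
  rewrite !mulr_sumr -big_split/=; apply: ler_sum => j _; rewrite /b.
  set v := z a j p.+1; set u := z a j p; set l := L%:R; set n := (m a j)%:R.
  have : 0 <= (v + (n + l) * u + (v + n * u)) ^+ 2 by rewrite sqr_ge0.
  lra.
move: ba; lra.
Qed.

End KaltonPeck.

(** * The Banach spaces F_n *)

Section Gauge.
Variable R : realType.
Local Notation arr := (nat -> nat -> R^o).
Implicit Types (z y : arr) (j k m n : nat) (r s : R).

Definition bounded_arr n z := exists r, inball n r z.

(** The infimum of the empty set is 0, so an array in no ball gets gauge 0; hence the explicit
    [bounded_arr] in what follows. *)
Definition gauge n z : R := inf [set r | inball n r z].

Lemma gauge_ge0 n z : 0 <= gauge n z.
Proof.
have [zr|nz] := pselect (bounded_arr n z).
  by apply: lb_le_inf => // r [].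
rewrite /gauge inf_out// => -[[r zr] _]; apply: nz; by exists r.
Qed.

Lemma gauge_le n r z : inball n r z -> gauge n z <= r.
Proof. by move=> zr; apply: ge_inf zr; exists 0 => s []. Qed.

Lemma inball_gauge n z : bounded_arr n z -> inball n (gauge n z) z.
Proof.
move=> zr; apply: inball_closed => s zs.
have [||t zt ts] := @inf_adherent R [set r | inball n r z] (s - gauge n z).
- by rewrite subr_gt0.
- by split=> //; exists 0 => t [].
- by apply: inball_le zt; rewrite ltW// (lt_le_trans ts)// /gauge addrC subrK.
Qed.

Lemma gauge0 n : gauge n 0 = 0.
Proof. by apply/le_anti; rewrite gauge_ge0 gauge_le//; exact: inball00. Qed.

Lemma gauge0_eq0 n z : bounded_arr n z -> gauge n z = 0 -> z = 0.
Proof. by move=> /inball_gauge + z0; rewrite z0; exact: inball0_eq0. Qed.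

Lemma bounded_arr0 n : bounded_arr n 0.
Proof. by exists 0; exact: inball00. Qed.

Lemma bounded_arrD n z y : bounded_arr n z -> bounded_arr n y ->
  bounded_arr n (z + y).
Proof. by move=> [r zr] [s ys]; exists (r + s); exact: inballD. Qed.

Lemma bounded_arrZ n (a : R) z : bounded_arr n z -> bounded_arr n (a *: z).
Proof. by move=> [r zr]; exists (`|a| * r); exact: inballZ. Qed.

Lemma gaugeD n z y : bounded_arr n z -> bounded_arr n y ->
  gauge n (z + y) <= gauge n z + gauge n y.
Proof. by move=> /inball_gauge zr /inball_gauge yr; exact/gauge_le/inballD. Qed.

Lemma gaugeZ n (a : R) z : bounded_arr n z -> gauge n (a *: z) = `|a| * gauge n z.
Proof.
have le (b : R) y : bounded_arr n y -> gauge n (b *: y) <= `|b| * gauge n y.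
  by move=> /inball_gauge yr; exact/gauge_le/inballZ.
move=> zr; have [->|a0] := eqVneq a 0; first by rewrite scale0r gauge0 normr0 mul0r.
apply/le_anti; rewrite le//= -ler_pdivlMl ?normr_gt0//.
have := le a^-1 (a *: z) (bounded_arrZ a zr).
by rewrite scalerA mulVf// scale1r normfV.
Qed.

(** Every ball condition is a closed condition on a continuous function of finitely many entries.
    This replaces Fatou's lemma in the proof of completeness. *)
Lemma inball_cvg (T : Type) (G : set_system T) (PG : ProperFilter G) (f : T -> arr)
    (l : arr) n r :
  (forall j k, f t j k @[t --> G] --> l j k) ->
  (\forall t \near G, inball n r (f t)) -> inball n r l.
Proof.
move=> fl fr.
have r0 : 0 <= r by have [t []] := @filter_ex _ _ PG _ fr.
split=> // [j k nk|J P m c cn].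
  apply: (closed_cvg (fun x : R => x = 0) (@closed_eq R 0) _ _ (fl j k)).
  by apply: filterS fr => t [_ + _]; apply.
pose S (z : arr) : R := \sum_(j < J | P j)
  (wt R (m j) * `|shiftn (m j) (z j) (c j)| - r * wt R (m j) ^+ 2).
apply: (closed_cvg (fun x : R => x <= r) (@closed_le R r) (_ : \forall t \near G, S (f t) <= r)).
  by apply: filterS fr => t [_ _]; apply.
have sh p j k : shiftn p (f t j) k @[t --> G] --> (shiftn p (l j) k : R).
  elim: p k => [|p IH] k; first exact: fl.
  rewrite shiftnS /shift; under eq_fun do rewrite shiftnS /shift.
  by apply: cvgD; [exact: IH|case: k => [|k]; [exact: cvg_cst|exact: IH]].
rewrite /S; apply: cvg_big => [|j _]; first exact: add_continuous.
apply: cvgB; last exact: cvg_cst.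
by apply: cvgM; [exact: cvg_cst|apply: cvg_norm; exact: sh].
Qed.

Definition bounded_pred n : {pred arr} := fun z => `[<bounded_arr n z>].

Lemma bounded_pred_submod n : GRing.subsemimod_closed (bounded_pred n).
Proof.
split; [split|].
- exact/asboolP/bounded_arr0.
- by move=> x y /asboolP xr /asboolP yr; exact/asboolP/bounded_arrD.
- by move=> a x /asboolP xr; exact/asboolP/bounded_arrZ.
Qed.

HB.instance Definition _ n :=
  GRing.isSubmodClosed.Build R arr (bounded_pred n) (@bounded_pred_submod n).

Record level n := Level { level_val : arr; _ : level_val \in bounded_pred n }.

HB.instance Definition _ n := [isSub for @level_val n].
HB.instance Definition _ n := [Choice of level n by <:].
HB.instance Definition _ n := [SubChoice_isSubLmodule of level n by <:].

Lemma levelP n (x : level n) : bounded_arr n (val x).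
Proof. by have := valP x => /asboolP. Qed.

Definition level_norm n (x : level n) : R := gauge n (val x).

Lemma level_normD n (x y : level n) :
  level_norm (x + y) <= level_norm x + level_norm y.
Proof. by rewrite /level_norm raddfD gaugeD//; exact: levelP. Qed.

Lemma level_normZ n (a : R) (x : level n) :
  level_norm (a *: x) = `|a| * level_norm x.
Proof. by rewrite /level_norm linearZ gaugeZ//; exact: levelP. Qed.

Lemma level_norm_eq0 n (x : level n) : level_norm x = 0 -> x = 0.
Proof. by move=> /(gauge0_eq0 (levelP x)) x0; exact: val_inj. Qed.

HB.instance Definition _ n := Lmodule_isNormed.Build R (level n)
  (@level_normD n) (@level_normZ n) (@level_norm_eq0 n).

Lemma level_normE n (x : level n) : `|x| = gauge n (val x).
Proof. by []. Qed.

Lemma level_inball n (x : level n) : inball n `|x| (val x).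
Proof. exact/inball_gauge/levelP. Qed.

Definition to_level n z (zb : bounded_arr n z) : level n :=
  @Level n z (asboolT zb).

Lemma level_complete n (G : set_system (level n)) :
  ProperFilter G -> cauchy G -> cvg G.
Proof.
move=> PG /cauchyP Gc.
have Gball e : 0 < e -> exists x, \forall y \near G, `|x - y| < e.
  by move=> /Gc[x]; rewrite -ball_normE; exists x.
have entry j k : exists l : R, (val y j k : R) @[y --> G] --> l.
  have PGjk := fmap_proper_filter (fun y : level n => val y j k : R) PG.
  apply/cvg_ex; apply: cauchy_cvg; apply: cauchy_exP => e e0.
  have [|x Gx] := Gball (e / 2); first by rewrite divr_gt0.
  exists (val x j k); rewrite -ball_normE /=; apply: filterS Gx => y xy.
  have := inball_entry j k (level_inball (x - y)); rewrite raddfB => /le_lt_trans; apply.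
  by rewrite mulrC -ltr_pdivlMr.
have rows j : exists f : nat -> R, forall k, (val y j k : R) @[y --> G] --> f k.
  by have [f fP] := choice (entry j); exists f.
have [l0 l0P] := choice rows.
pose l : arr := l0.
(* [x] stays fixed while [y] tends entrywise to [l] inside a ball around [x]. *)
have near_l e : 0 < e -> exists x : level n, inball n e (val x - l) /\ \forall y \near G, `|x - y| < e.
  move=> /[dup] e0 /Gball[x Gx]; exists x; split=> //.
  have H := @inball_cvg _ G PG (fun y : level n => val x - val y : arr) (val x - l) n e.
  apply: H => [j k|].
    rewrite !fctE; under eq_fun do rewrite !fctE.
    by apply: cvgB; [exact: cvg_cst|exact: l0P].
  apply: filterS Gx => y /ltW xy; apply: inball_le xy _.
  by have := level_inball (x - y); rewrite raddfB.
have lb : bounded_arr n l.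
  have [|x [xl _]] := near_l 1; first by [].
  have [r xr] := levelP x; exists (r + 1).
  by have := inballB xr xl; rewrite opprB addrCA subrr addr0.
apply/cvg_ex; exists (to_level lb); apply/fcvgrPdist_lt => e e0.
have [|x [xl Gx]] := near_l (e / 2); first by rewrite divr_gt0.
apply: filterS Gx => y xy; rewrite -(subrKA x) (le_lt_trans (ler_normD _ _))//.
rewrite (splitr e) ler_ltD// distrC level_normE raddfB.
exact: gauge_le.
Qed.

HB.instance Definition _ n := Uniform_isComplete.Build (level n) (@level_complete n).

End Gauge.

(** * The projective limit as a locally convex space *)

Section Tower.
Variable R : realType.
Local Notation arr := (nat -> nat -> R^o).
Implicit Types (z y : arr) (j k m n : nat) (r s : R).

Lemma cutD n z y : cut n (z + y) = cut n z + cut n y.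
Proof.
apply/funext => j; apply/funext => k; rewrite /cut !fctE.
by case: ifP; rewrite ?addr0.
Qed.

Lemma cutZ n (a : R) z : cut n (a *: z) = a *: cut n z.
Proof.
apply/funext => j; apply/funext => k; rewrite /cut !fctE.
by case: ifP; rewrite ?scaler0.
Qed.

Lemma cut_cut n m z : (n <= m)%N -> cut n (cut m z) = cut n z.
Proof.
move=> nm; apply/funext => j; apply/funext => k; rewrite /cut.
by case: ifP => // kn; rewrite (leq_trans kn).
Qed.

Lemma cut_id n r z : inball n r z -> cut n z = z.
Proof.
move=> [_ z0 _]; apply/funext => j; apply/funext => k; rewrite /cut.
by case: ltnP => // nk; rewrite z0.
Qed.

Definition seminorm n z : R := gauge n (cut n z).

(** The connecting maps are truncations, so a compatible sequence is encoded by the one array of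
    which its members are the truncations. *)
Definition in_tower z := forall n, bounded_arr n (cut n z).

Lemma in_tower0 : in_tower 0.
Proof.
move=> n; have -> : cut n (0 : arr) = 0; last exact: bounded_arr0.
by apply/funext => j; apply/funext => k; rewrite /cut; case: ifP.
Qed.

Lemma in_towerD z y : in_tower z -> in_tower y -> in_tower (z + y).
Proof. by move=> zt yt n; rewrite cutD; exact: bounded_arrD. Qed.

Lemma in_towerZ (a : R) z : in_tower z -> in_tower (a *: z).
Proof. by move=> zt n; rewrite cutZ; exact: bounded_arrZ. Qed.

Lemma seminorm_ge0 n z : 0 <= seminorm n z.
Proof. exact: gauge_ge0. Qed.

Lemma seminormD n z y : in_tower z -> in_tower y ->
  seminorm n (z + y) <= seminorm n z + seminorm n y.
Proof. by move=> zt yt; rewrite /seminorm cutD gaugeD. Qed.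

Lemma seminormZ n (a : R) z : in_tower z -> seminorm n (a *: z) = `|a| * seminorm n z.
Proof. by move=> zt; rewrite /seminorm cutZ gaugeZ. Qed.

Lemma seminorm_inball n z : in_tower z -> inball n (seminorm n z) (cut n z).
Proof. by move=> zt; exact: inball_gauge. Qed.

Lemma seminorm_le n m z : (n <= m)%N -> in_tower z -> seminorm n z <= seminorm m z.
Proof.
move=> /subnKC <-; elim: (m - n)%N => [|i IH] zt; first by rewrite addn0.
apply: le_trans (IH zt) _; rewrite addnS; apply: gauge_le.
by have := inball_cut (seminorm_inball (n + i).+1 zt); rewrite cut_cut.
Qed.

Lemma seminorm_eq0 z : in_tower z -> (forall n, seminorm n z = 0) -> z = 0.
Proof.
move=> zt z0; apply/funext => j; apply/funext => k.
have := gauge0_eq0 (zt k.+1) (z0 k.+1).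
by move=> /(congr1 (fun f : arr => f j k)); rewrite /cut ltnSn.
Qed.

Definition tower_pred : {pred arr} := fun z => `[<in_tower z>].

Lemma tower_pred_submod : GRing.subsemimod_closed tower_pred.
Proof.
split; [split|].
- exact/asboolP/in_tower0.
- by move=> x y /asboolP xr /asboolP yr; exact/asboolP/in_towerD.
- by move=> a x /asboolP xr; exact/asboolP/in_towerZ.
Qed.

HB.instance Definition _ :=
  GRing.isSubmodClosed.Build R arr tower_pred tower_pred_submod.

Record tower := Tower { tower_val : arr; _ : tower_val \in tower_pred }.

HB.instance Definition _ := [isSub for @tower_val].
HB.instance Definition _ := [Choice of tower by <:].
HB.instance Definition _ := [SubChoice_isSubLmodule of tower by <:].

Implicit Types (x : tower).

Lemma towerP x : in_tower (val x).
Proof. by have := valP x => /asboolP. Qed.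

Definition to_tower z (zt : in_tower z) : tower := @Tower z (asboolT zt).

Definition tnorm n x : R := seminorm n (val x).

Lemma tnormD n x x' : tnorm n (x + x') <= tnorm n x + tnorm n x'.
Proof. by rewrite /tnorm raddfD seminormD//; exact: towerP. Qed.

Lemma tnormZ n (a : R) x : tnorm n (a *: x) = `|a| * tnorm n x.
Proof. by rewrite /tnorm linearZ seminormZ//; exact: towerP. Qed.

Lemma tnormN n x : tnorm n (- x) = tnorm n x.
Proof. by rewrite -scaleN1r tnormZ normrN1 mul1r. Qed.

Lemma tnormB n x x' : tnorm n (x - x') = tnorm n (x' - x).
Proof. by rewrite -opprB tnormN. Qed.

Lemma tnorm0 n : tnorm n 0 = 0.
Proof. by rewrite -(scale0r 0) tnormZ normr0 mul0r. Qed.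

Lemma tnorm_ge0 n x : 0 <= tnorm n x.
Proof. exact: seminorm_ge0. Qed.

Lemma tnorm_le n m x : (n <= m)%N -> tnorm n x <= tnorm m x.
Proof. by move=> nm; exact/seminorm_le/towerP. Qed.

Lemma tnorm_eq0 x : (forall n, tnorm n x = 0) -> x = 0.
Proof. by move=> x0; apply: val_inj; apply: seminorm_eq0 => //; exact: towerP. Qed.

Lemma tnorm_triangle n x x' x'' : tnorm n (x - x'') <= tnorm n (x - x') + tnorm n (x' - x'').
Proof. by rewrite -(subrKA x') tnormD. Qed.

Definition tball x n (e : R) : set tower := [set y | tnorm n (y - x) < e].

(** The seminorms increase with [n], so balls of single seminorms already form a neighbourhood
    base. *)
Definition tower_nbhs x : set_system tower :=
  [set U | exists n e, 0 < e /\ tball x n e `<=` U].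

HB.instance Definition _ := hasNbhs.Build tower tower_nbhs.

Lemma tball_center x n e : 0 < e -> tball x n e x.
Proof. by rewrite /tball /= subrr tnorm0. Qed.

Lemma tball_anti x n m e d : (n <= m)%N -> d <= e -> tball x m d `<=` tball x n e.
Proof. by move=> nm de y xy; rewrite /tball/= (le_lt_trans (tnorm_le _ nm))// (lt_le_trans xy). Qed.

Lemma tower_nbhs_filter x : ProperFilter (nbhs x).
Proof.
split; first by move=> [n [e [e0]]] /(_ x (tball_center x n e0)).
split.
- by exists 0%N, 1; split.
- move=> U V [n [e [e0 nU]]] [m [d [d0 mV]]].
  exists (maxn n m), (Num.min e d); split; first by rewrite lt_min e0 d0.
  move=> y xy; split.
    by apply/nU/(tball_anti _ _ xy); rewrite ?leq_maxl ?ge_min ?lexx.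
  by apply/mV/(tball_anti _ _ xy); rewrite ?leq_maxr ?ge_min ?lexx ?orbT.
- by move=> U V UV [n [e [e0 nU]]]; exists n, e; split=> // y /nU/UV.
Qed.

Lemma tball_nbhs x n e (y : tower) : tball x n e y -> nbhs y (tball x n e).
Proof.
rewrite /tball/= => xy; exists n, (e - tnorm n (y - x)); split; first by rewrite subr_gt0.
move=> t; rewrite /tball/= ltrBrDr; apply: le_lt_trans.
exact: tnorm_triangle.
Qed.

Lemma tower_nbhs_singleton x U : nbhs x U -> U x.
Proof. by move=> [n [e [e0]]]; apply; exact: tball_center. Qed.

Lemma tower_nbhs_nbhs x U : nbhs x U -> nbhs x (nbhs^~ U).
Proof.
move=> [n [e [e0 nU]]]; exists n, e; split=> // y /tball_nbhs[m [d [d0 H]]].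
by exists m, d; split=> // t /H/nU.
Qed.

HB.instance Definition _ := Nbhs_isNbhsTopological.Build tower
  tower_nbhs_filter tower_nbhs_singleton tower_nbhs_nbhs.

Lemma tower_add_continuous : continuous (fun x : tower * tower => x.1 + x.2).
Proof.
move=> [x x'] /= U [n [e [e0 nU]]].
have e2 : 0 < e / 2 by rewrite divr_gt0.
exists (tball x n (e / 2), tball x' n (e / 2)).
  by split; apply: tball_nbhs; exact: tball_center.
move=> [y y'] [/= xy xy']; apply: nU; rewrite /tball/= opprD addrACA.
by rewrite (le_lt_trans (tnormD _ _ _))// (splitr e) ltrD.
Qed.

Lemma tower_scale_continuous : continuous (fun z : R^o * tower => z.1 *: z.2).
Proof.
move=> [a x] /= U [n [e [e0 nU]]].
have c0 : 0 < tnorm n x + 1 by rewrite ltr_wpDl// tnorm_ge0.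
(* The radii are made for the splitting [b *: (y - x) + (b - a) *: x]; the 1 in the minimum keeps
   [|b|] below [|a| + 1]. *)
have d0 : 0 < Num.min 1 (e / 2 / (tnorm n x + 1)).
  by rewrite lt_min ltr01 !divr_gt0.
have a0 : 0 < `|a| + 1 by rewrite ltr_wpDl.
exists (ball a (Num.min 1 (e / 2 / (tnorm n x + 1))), tball x n (e / 2 / (`|a| + 1))).
  split; first exact: nbhsx_ballx.
  by apply: tball_nbhs; apply: tball_center; rewrite !divr_gt0.
move=> [b y] [/=]; rewrite -ball_normE/= lt_min => /andP[ab1 ab2] xy.
apply: nU; rewrite /tball/=.
have -> : b *: y - a *: x = b *: (y - x) + (b - a) *: x.
  by rewrite scalerBr scalerBl addrA subrK.
rewrite (le_lt_trans (tnormD _ _ _))// !tnormZ (splitr e) ler_ltD//.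
  have bn : `|b| <= `|a| + 1.
    by rewrite -lerBlDl (le_trans (ler_norm _))// (le_trans (ler_dist_dist _ _))// distrC ltW.
  rewrite (le_trans (ler_wpM2r (tnorm_ge0 _ _) bn))//.
  by rewrite mulrC -ler_pdivlMr// ltW.
rewrite distrC (le_lt_trans (_ : _ <= `|a - b| * (tnorm n x + 1)))//.
  by rewrite ler_wpM2l// lerDl.
by rewrite -ltr_pdivlMr.
Qed.

Lemma tower_locally_convex :
  exists2 B : set_system tower, (forall b, b \in B -> convex_set b) & basis B.
Proof.
exists [set B | exists x n e, B = tball x n e].
  move=> b /set_mem[x [n [e ->]]].
  apply/convex_setW => y y' /set_mem xy /set_mem xy' l l0 l1.
  apply/mem_set; change (tnorm n (l%:num *: y + (1 - l%:num) *: y' - x) < e).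
  have -> : l%:num *: y + (1 - l%:num) *: y' - x = l%:num *: (y - x) + (1 - l%:num) *: (y' - x).
    by rewrite !scalerBr addrACA -opprD -scalerDl addrCA subrr addr0 scale1r.
  rewrite (le_lt_trans (tnormD _ _ _))// !tnormZ.
  rewrite (ger0_norm (ltW l0)) ger0_norm ?subr_ge0 ?(ltW l1)//.
  have {xy} : tnorm n (y - x) < e by exact: xy.
  have {xy'} : tnorm n (y' - x) < e by exact: xy'.
  move: (tnorm n (y' - x)) (tnorm n (y - x)) (l%:num) l0 l1 => d c t t0 t1 de ce.
  have := ltr_pM2l t0 c e; have : 0 < 1 - t by rewrite subr_gt0.
  by move=> /ltr_pM2l/(_ d e); rewrite de ce; lra.
split; first by move=> _ [x [n [e ->]]]; rewrite openE => y; exact: tball_nbhs.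
move=> x U [n [e [e0 nU]]]; exists (tball x n e) => //; split; first by exists x, n, e.
exact: tball_center.
Qed.

HB.instance Definition _ := PreTopologicalLmod_isTvs.Build R tower
  tower_add_continuous tower_scale_continuous tower_locally_convex.
HB.instance Definition _ :=
  PreTopologicalNmodule_isTopologicalNmodule.Build tower tower_add_continuous.
HB.instance Definition _ :=
  TopologicalNmodule_isTopologicalLmodule.Build R tower tower_scale_continuous.
HB.instance Definition _ := Uniform_isTvs.Build R tower tower_locally_convex.

End Tower.

(** * The limit is a Frechet space and a quojection *)

Section Quojection.
Variable R : realType.
Local Notation arr := (nat -> nat -> R^o).
Local Notation tower := (tower R).
Local Notation level := (level R).

Lemma bounded_cut n (x : level n.+1) : bounded_arr n (cut n (val x)).
Proof. by have [r /inball_cut xr] := levelP x; exists r. Qed.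

Definition restr n (x : level n.+1) : level n := to_level (bounded_cut x).

Definition proj n (x : tower) : level n := to_level (towerP x n).

Lemma restr_linear n : linear (@restr n).
Proof.
move=> a x y; apply: val_inj; rewrite linearP.
change (cut n (val (a *: x + y)) = a *: cut n (val x) + cut n (val y)).
by rewrite linearP cutD cutZ.
Qed.

HB.instance Definition _ n := GRing.isLinear.Build R (level n.+1) (level n) *:%R
  (@restr n) (@restr_linear n).

Lemma proj_linear n : linear (@proj n).
Proof.
move=> a x y; apply: val_inj; rewrite linearP.
change (cut n (val (a *: x + y)) = a *: cut n (val x) + cut n (val y)).
by rewrite linearP cutD cutZ.
Qed.

HB.instance Definition _ n := GRing.isLinear.Build R tower (level n) *:%R
  (@proj n) (@proj_linear n).

Lemma norm_proj n (x : tower) : `|proj n x| = tnorm n x.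
Proof. by []. Qed.

Lemma norm_restr n (x : level n.+1) : `|restr x| <= `|x|.
Proof. exact/gauge_le/inball_cut/level_inball. Qed.

Lemma restr_proj n x : restr (proj n.+1 x) = proj n x.
Proof. by apply: val_inj; rewrite /= cut_cut. Qed.

Lemma restr_continuous n : continuous (@restr n).
Proof.
move=> x; apply/(@cvgrPdist_lt _ (level n) (level n.+1) (nbhs x)) => e e0.
apply: filterS (nbhsx_ballx x e e0) => y; rewrite -ball_normE/= => xy.
by rewrite -linearB (le_lt_trans (norm_restr _)).
Qed.

Lemma proj_continuous n : continuous (@proj n).
Proof.
move=> x; apply/(@cvgrPdist_lt _ (level n) tower (nbhs x)) => e e0; exists n, e; split=> // y.
by rewrite -linearB norm_proj tnormB.
Qed.

Lemma restr_surj n (b : level n) : exists c, restr c = b.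
Proof.
(* [inball_lift] needs a positive radius, also for [b = 0]. *)
have b1 : inball n (`|b| + 1) (val b).
  by apply: inball_le (level_inball b); rewrite lerDl.
have [|y [yb yr]] := inball_lift _ b1; first by rewrite ltr_wpDl.
have yB : bounded_arr n.+1 y by eexists; exact: yr.
exists (to_level yB); apply: val_inj; rewrite /= -[RHS](cut_id b1).
apply/funext => j; apply/funext => k; rewrite /cut.
by case: ifP => // kn; rewrite yb// ltn_eqF.
Qed.

Lemma proj_inj (x y : tower) : (forall n, proj n x = proj n y) -> x = y.
Proof.
move=> xy; apply/eqP; rewrite -subr_eq0; apply/eqP/tnorm_eq0 => n.
by rewrite -norm_proj linearB/= xy subrr normr0.
Qed.

Lemma proj_compatible (y : forall n, level n) :
  (forall n, restr (y n.+1) = y n) -> exists x, forall n, proj n x = y n.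
Proof.
move=> yc; have agree n m j k : (k < n)%N -> (n <= m)%N -> val (y m) j k = val (y n) j k.
  move=> kn /subnKC <-; elim: (m - n)%N => [|i IH]; first by rewrite addn0.
  by rewrite -IH -(yc (n + i)%N) addnS /= /cut (leq_trans kn (leq_addr _ _)).
(* Column [k] first appears at level [k.+1] and is constant from there on. *)
pose z : arr := fun j k => val (y k.+1) j k.
have zE n : cut n z = val (y n).
  rewrite -[RHS](cut_id (level_inball (y n))).
  apply/funext => j; apply/funext => k; rewrite /cut; case: ifP => // kn.
  by rewrite /z (agree k.+1 n).
have zt : in_tower z by move=> n; rewrite zE; exact: levelP.
by exists (to_tower zt) => n; apply: val_inj; rewrite /= zE.
Qed.

Lemma tower_hausdorff : hausdorff_space tower.
Proof.
move=> x y xy; apply/eqP; rewrite -subr_eq0; apply/eqP/tnorm_eq0 => n.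
apply/eqP; apply: contraT => xy0.
have d0 : 0 < tnorm n (x - y) / 2 by rewrite divr_gt0// lt0r xy0 tnorm_ge0.
have [||t []] := xy (tball x n (tnorm n (x - y) / 2)) (tball y n (tnorm n (x - y) / 2)).
- by apply: tball_nbhs; exact: tball_center.
- by apply: tball_nbhs; exact: tball_center.
rewrite /tball/= => xt ty; have := tnorm_triangle n x t y.
by rewrite leNgt (tnormB n x t) [ltRHS](splitr (tnorm n (x - y))) ltrD.
Qed.

Lemma tower_countable_base : exists B : nat -> set tower,
  (forall n, nbhs (0 : tower) (B n)) /\
  (forall U, nbhs (0 : tower) U -> exists n, B n `<=` U).
Proof.
exists (fun n => tball 0 n (wt R n)); split=> [n|U [n [e [e0 nU]]]].
  by apply: tball_nbhs; apply: tball_center; exact: wt_gt0.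
have [m me] := wt_small e0; exists (n + m)%N; apply: subset_trans nU.
apply: tball_anti; first exact: leq_addr.
by rewrite wtD (le_trans _ me)// ler_piMl ?wt_ge0 ?wt_le1.
Qed.

Lemma tower_cauchy (G : set_system tower) n e : ProperFilter G -> cauchy G -> 0 < e ->
  exists2 A, G A & forall x y, A x -> A y -> tnorm n (x - y) < e.
Proof.
move=> PG Gc e0.
have [|[A B] [/= GA GB] AB] := Gc [set xy | tnorm n (xy.1 - xy.2) < e].
  exists (tball 0 n e); split; first by apply: tball_nbhs; exact: tball_center.
  by move=> [x y]; rewrite !inE /tball/= subr0.
have [x []] := @filter_ex _ _ PG _ (filterI GA GB).
move=> Ax Bx; exists (A `&` B); first exact: filterI.
by move=> y y' [Ay _] [_ By']; exact: (AB (y, y')).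
Qed.

Lemma tower_complete (G : set_system tower) : ProperFilter G -> cauchy G ->
  exists x : tower, G --> x.
Proof.
move=> PG Gc.
have level_lim n : exists l : level n, proj n y @[y --> G] --> l.
  have PGn := fmap_proper_filter (@proj n) PG.
  apply/cvg_ex; apply: cauchy_cvg; apply: cauchy_exP => e e0.
  have [A GA Ae] := tower_cauchy n PG Gc e0.
  have [x Ax] := @filter_ex _ _ PG _ GA.
  exists (proj n x); rewrite -ball_normE/=; apply: filterS GA => y Ay /=.
  by rewrite -linearB; exact: Ae.
pose l n := sval (cid (level_lim n)).
have lP n : proj n y @[y --> G] --> l n by exact: svalP (cid (level_lim n)).
have [x xl] : exists x, forall n, proj n x = l n.
  apply: proj_compatible => n.
  have PGn := fmap_proper_filter (@proj n) PG.
  apply: (@cvg_unique _ (@norm_hausdorff _ (level n)) (proj n @ G)); last exact: lP.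
  have -> : @proj n = @restr n \o @proj n.+1.
    by apply/funext => y; rewrite /= restr_proj.
  exact: cvg_comp (lP n.+1) (@restr_continuous n (l n.+1)).
exists x => U [n [e [e0 nU]]]; have /cvgrPdist_lt/(_ e e0) := lP n.
by apply: filterS => y; rewrite -xl -linearB norm_proj tnormB => /nU.
Qed.

Lemma tower_frechet : @frechet R tower.
Proof.
split; [exact: tower_hausdorff|exact: tower_countable_base|exact: tower_complete].
Qed.

Lemma tower_quojection : @quojection R tower.
Proof.
split; first exact: tower_frechet.
exists (fun n => level n), (fun n => @restr n); split; first exact: restr_continuous.
split; first exact: restr_surj.
exists (fun n => @proj n); split.
- by move=> n x; exact: restr_proj.
- exact: proj_continuous.
- exact: proj_inj.
- exact: proj_compatible.
- move=> U [n [e [e0 nU]]]; exists [:: n], (fun m => ball (0 : level m) e).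
  split=> [m _|x /(_ n (mem_head _ _))]; first exact: nbhsx_ballx.
  rewrite -ball_normE/= sub0r normrN norm_proj => xe.
  by apply: nU; rewrite /tball/= subr0.
Qed.

End Quojection.

(** * Infinite-dimensional subspaces under finitely many conditions *)

Section Dimension.
Variables (R : realType) (V : lmodType R).
Implicit Type S : set V.

Lemma lin_subspace_sum S (I : finType) (c : I -> R) (v : I -> V) :
  lin_subspace S -> (forall i, S (v i)) -> S (\sum_i c i *: v i).
Proof.
move=> [S0 SD SZ] Sv; apply: (big_ind S) => // i _; exact: SZ.
Qed.

(* Grouping [n * r] independent vectors into [n] blocks of [r], each block has a
   nonzero combination on which [P] holds. *)
Lemma infinite_dim_sub S (P : set V) r : lin_subspace S -> infinite_dim S ->
  (forall v : 'I_r -> V, (forall i, S (v i)) ->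
    exists c : 'I_r -> R, (exists i, c i != 0) /\ P (\sum_i c i *: v i)) ->
  infinite_dim (S `&` P).
Proof.
move=> Ssub Sinf SP n; have [v [Sv vfree]] := Sinf #|{: 'I_n * 'I_r}|.
pose w (i : 'I_n) (j : 'I_r) := v (enum_rank (i, j)).
have H i : exists c : 'I_r -> R, (exists j, c j != 0) /\ P (\sum_j c j *: w i j).
  by apply: SP => j; exact: Sv.
have [c cP] := choice H.
exists (fun i => \sum_j c i j *: w i j); split=> [i|d d0 i].
  by split; [apply: lin_subspace_sum => // j; exact: Sv|case: (cP i)].
have [[j cj0] _] := cP i.
pose f (k : 'I_#|{: 'I_n * 'I_r}|) := d (enum_val k).1 * c (enum_val k).1 (enum_val k).2.
have /(_ (enum_rank (i, j))) : forall k, f k = 0.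
  apply: vfree; rewrite -[RHS]d0.
  rewrite (reindex enum_rank)/=; last by apply: onW_bij; exact: enum_rank_bij.
  under [RHS]eq_bigr do rewrite scaler_sumr.
  rewrite pair_bigA/=; apply: eq_bigr => -[a b] _ /=.
  by rewrite /f enum_rankK/= scalerA.
by rewrite /f enum_rankK/= => /eqP; rewrite mulf_eq0 (negbTE cj0) orbF => /eqP.
Qed.

(** Blocks of two vectors suffice, since two scalars always satisfy a nontrivial linear relation. *)
Lemma infinite_dim_ker S (f : V -> R) : lin_subspace S -> infinite_dim S ->
  (forall a x y, f (a *: x + y) = a * f x + f y) ->
  infinite_dim (S `&` [set x | f x = 0]).
Proof.
move=> Ssub Sinf flin; apply: (@infinite_dim_sub _ _ 2) => // v Sv.
have f0 : f 0 = 0 by have := flin 1 0 0; rewrite scale1r addr0 mul1r => /eqP; rewrite addrC -subr_eq subrr eq_sym => /eqP.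
have fE (c d : R) (x y : V) : f (c *: x + d *: y) = c * f x + d * f y.
  by rewrite flin -[d *: y]addr0 flin f0 addr0.
have [v0|v0] := eqVneq (f (v ord0)) 0.
  exists (fun i => if i == ord0 then 1 else 0); split; first by exists ord0; rewrite eqxx oner_eq0.
  by rewrite big_ord_recl big_ord1/= fE v0 mulr0 mul0r addr0.
exists (fun i => if i == ord0 then - f (v (lift ord0 ord0)) else f (v ord0)); split.
  by exists (lift ord0 ord0).
rewrite big_ord_recl big_ord1/= fE; ring.
Qed.

Lemma infinite_dim_nonzero S : infinite_dim S -> exists2 x, S x & x != 0.
Proof.
move=> /(_ 1%N)[v [Sv vfree]]; exists (v ord0) => //; apply/eqP => v0.
have := vfree (fun=> 1) _ ord0; rewrite big_ord1 v0 scaler0 => /(_ erefl)/eqP.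
by rewrite oner_eq0.
Qed.

End Dimension.

(** * Gliding hump: almost disjoint blocks in a subspace *)

Section Blocks.
Variable R : realType.
Local Notation arr := (nat -> nat -> R^o).
Implicit Types (x y z : arr) (S : set arr) (p n J : nat).

Lemma cut_sum n N (e : nat -> R) (x : nat -> arr) :
  cut n (\sum_(a < N) e a *: x a) = \sum_(a < N) e a *: cut n (x a).
Proof.
elim: N => [|N IH]; last by rewrite !big_ord_recr/= cutD cutZ IH.
by rewrite !big_ord0; apply/funext => j; apply/funext => k; rewrite /cut; case: ifP.
Qed.

Lemma cutB n x y : cut n (x - y) = cut n x - cut n y.
Proof. by rewrite -scaleN1r cutD cutZ scaleN1r. Qed.

Lemma inball_sum n r N (e : nat -> R) (z : nat -> arr) : signs e ->
  (forall a, inball n r (z a)) -> inball n (N%:R * r) (\sum_(a < N) e a *: z a).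
Proof.
move=> es zr; elim: N => [|N IH]; first by rewrite big_ord0 mul0r; exact: inball00.
rewrite big_ord_recr/= -natr1 mulrDl; apply: inballD => //.
by have := inballZ (e N) (zr N); rewrite signs_norm.
Qed.

(** Past a partial sum within [e] of the supremum of all partial sums, at most [e] can be added. *)
Lemma tail_small (a : nat -> R) (B e : R) : (forall j, 0 <= a j) ->
  (forall J, \sum_(j < J) a j <= B) -> 0 < e ->
  exists J', forall J, \sum_(j < J | (J' <= j)%N) a j <= e.
Proof.
move=> a0 aB e0; pose A := [set s | exists J, s = \sum_(j < J) a j].
have supA : has_sup A.
  split; first by exists (\sum_(j < 0) a j), 0%N.
  by exists B => _ [J ->].
have [_ [J' ->] lt] := sup_adherent e0 supA; exists J' => J.
have [JJ'|J'J] := leqP J J'.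
  rewrite big_pred0 ?(ltW e0)// => j; apply/negbTE; rewrite -ltnNge.
  exact: leq_trans JJ'.
have : \sum_(j < J) a j <= sup A by apply: (sup_upper_bound supA); exists J.
rewrite (bigID (fun j : 'I_J => (J' <= j)%N))/=.
have -> : \sum_(j < J | ~~ (J' <= j)%N) a j = \sum_(j < J') a j.
  rewrite (big_ord_widen_cond J xpredT a (ltnW J'J)) //=.
  by apply: eq_bigl => j; rewrite -ltnNge.
move: lt; lra.
Qed.

Definition vanishing S (s : seq (nat * nat)) :=
  S `&` [set x | forall jk, jk \in s -> x jk.1 jk.2 = 0].

Lemma lin_subspace_vanishing S s : lin_subspace S -> lin_subspace (vanishing S s).
Proof.
move=> [S0 SD SZ]; split; first by split.
- move=> x y [Sx x0] [Sy y0]; split; first exact: SD.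
  by move=> jk jks; rewrite !fctE x0// y0// addr0.
- move=> a x [Sx x0]; split; first exact: SZ.
  by move=> jk jks; rewrite !fctE x0// scaler0.
Qed.

Lemma infinite_dim_vanishing S s : lin_subspace S -> infinite_dim S ->
  infinite_dim (vanishing S s).
Proof.
move=> Ssub Sinf; elim: s => [|[j k] s IH].
  by rewrite /vanishing (_ : [set x | _] = setT) ?setIT// -subTset => x _ jk.
have := @infinite_dim_ker R arr _ (fun x => x j k) (lin_subspace_vanishing s Ssub) IH
  (fun _ _ _ => erefl).
congr infinite_dim; rewrite /vanishing -setIA; congr (_ `&` _).
apply/seteqP; split=> [x [x1 x2] jk|x x0].
  by rewrite inE => /predU1P[->|/x1].
split=> [jk jks|]; first by apply: x0; rewrite inE jks orbT.
by apply: (x0 (j, k)); exact: mem_head.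
Qed.

(** If seminorm [p] is nowhere comparable with seminorm [p.+1], some normalised [x] is nearly
    invisible in F_p. Small corrections then put its image in F_(p+1) into column [p], cut that
    column to finitely many rows, and are lifted to F_(p+2). *)
Lemma block_step S p : lin_subspace S -> (forall x, S x -> in_tower x) ->
  infinite_dim S ->
  (forall S' (t : R), S' `<=` S -> lin_subspace S' -> infinite_dim S' -> 0 < t ->
    exists2 x, S' x & seminorm p x < t * seminorm p.+1 x) ->
  forall J (e : R), 0 < e -> exists x J' z,
    [/\ S x, seminorm p.+1 x = 1, inball p.+2 e (cut p.+2 x - z),
      forall j k, (k < p)%N -> z j k = 0 &
      (J <= J')%N /\ forall j, z j p != 0 -> (J <= j < J')%N].
Proof.
move=> Ssub St Sinf small J e e0.
(* [c1] and [c3] are the costs of lifting to levels [p.+1] and [p.+2], [c2] that of [inball_lead];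
   [t] makes the whole correction have size [e]. *)
pose c1 : R := 2 ^+ (p + 5); pose c2 : R := 2 ^+ p.+1 * 5; pose c3 : R := 2 ^+ (p.+1 + 5).
have c10 : 0 < c1 by rewrite exprn_gt0.
have c20 : 0 < c2 by rewrite mulr_gt0 ?exprn_gt0.
have c30 : 0 < c3 by rewrite exprn_gt0.
have c120 : 0 < c1 + c2 by rewrite addr_gt0.
pose t := e / (c3 * (c1 + c2)).
have t0 : 0 < t by rewrite divr_gt0// mulr_gt0.
(* Finitely many entries are forced to vanish, so that the block avoids all rows below [J]. *)
pose s := [seq (j, k) | j <- iota 0 J, k <- iota 0 p.+1].
have S1sub := lin_subspace_vanishing s Ssub.
have S1inf := infinite_dim_vanishing s Ssub Sinf.
have [|x1 [Sx1 x1s] x1t] := small _ t _ S1sub S1inf t0; first by move=> ? [].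
have nx1 : 0 < seminorm p.+1 x1.
  by rewrite -(pmulr_rgt0 _ t0); apply: le_lt_trans x1t; exact: seminorm_ge0.
pose x := (seminorm p.+1 x1)^-1 *: x1.
have Sx : S x by case: Ssub => _ _; apply.
have xt : in_tower x := St _ Sx.
have x_head j k : (j < J)%N -> (k <= p)%N -> x j k = 0.
  move=> jJ kp; rewrite /x !fctE (x1s (j, k)) ?scaler0//.
  by apply/allpairsP; exists (j, k); rewrite !mem_iota.
have xn : seminorm p.+1 x = 1.
  by rewrite seminormZ ?ger0_norm ?invr_ge0 ?ltW// ?mulVf ?gt_eqF//; exact: St.
have xp : inball p t (cut p x).
  apply: inball_le (seminorm_inball p xt).
  rewrite seminormZ ?ger0_norm ?invr_ge0 ?(ltW nx1)//; last exact: St.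
  by rewrite mulrC ler_pdivrMr// ltW.
have xp1 : inball p.+1 1 (cut p.+1 x) by rewrite -xn; exact: seminorm_inball.
have [y0 [y0x y0b]] := inball_lift t0 xp.
(* Rows below [J] can be cleared from the lift, because [x] vanishes there up to column [p]. *)
pose y : arr := fun j k => if (J <= j)%N then y0 j k else 0.
have yb : inball p.+1 (c1 * t) y := inball_restrict (fun j => (J <= j)%N) y0b.
pose u j : R := x j p - y j p.
have uE : cut p.+1 x - y = lead p u.
  apply/funext => j; apply/funext => k; rewrite /lead !fctE.
  have [->|kp] := eqVneq k p; first by rewrite /cut ltnSn.
  rewrite /cut /y ltnS leq_eqVlt (negbTE kp)/=; case: ltnP => kp'; case: leqP => jJ.
  - by rewrite y0x// /cut kp' subrr.
  - by rewrite x_head ?subr0// ltnW.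
  - by rewrite y0x// /cut ltnNge kp' subrr.
  - by rewrite subr0.
have ub J0 : \sum_(j < J0) u j ^+ 2 <= 128 * (1 + c1 * t) ^+ 2.
  have /inball_lead_coord : inball p.+1 (1 + c1 * t) (lead p u) by rewrite -uE; exact: inballB.
  move=> /(_ J0); under eq_bigr do rewrite /lead eqxx; apply.
    by rewrite addr_gt0// mulr_gt0.
  by move=> j k kp; rewrite /lead ltn_eqF.
(* The column [u] is square summable, so it has a tail [v] of l_2 norm at most [t]. *)
have [J1 J1P] := tail_small (fun j => sqr_ge0 (u j)) ub (exprn_gt0 2 t0).
pose J' := maxn J J1.
pose v j : R := if (J' <= j)%N then u j else 0.
have vb : inball p.+1 (c2 * t) (lead p v).
  rewrite /c2 mulrAC; apply: inball_lead => // J0.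
  apply: le_trans (J1P J0); rewrite [leRHS]big_mkcond/=; apply: ler_sum => j _.
  rewrite /v geq_max; case: (J <= j)%N; case: (J1 <= j)%N => //=; rewrite ?expr0n ?sqr_ge0//.
have yvb : inball p.+1 ((c1 + c2) * t) (y + lead p v) by rewrite mulrDl; exact: inballD.
(* Subtracting a lift of [y + lead p v] leaves zeros before column [p] and the finite section
   [u - v] in it. *)
have [Y [YE Yb]] := inball_lift (mulr_gt0 c120 t0) yvb.
have {}Yb : inball p.+2 e Y.
  apply: inball_le Yb; rewrite -/c3 /t le_eqVlt; apply/orP; left; apply/eqP.
  by field; rewrite !gt_eqF.
exists x, J', (cut p.+2 x - Y); split=> //.
- by rewrite opprB addrCA subrr addr0.
- move=> j k kp; rewrite !fctE YE ?ltn_eqF// 1?ltnW// !fctE /lead (ltn_eqF kp) addr0.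
  rewrite /cut (ltn_trans kp) ?leqnSn// ?(leqW (ltnSn _))//.
  have := congr1 (fun f : arr => f j k) uE; rewrite !fctE /lead /cut (ltn_eqF kp).
  by rewrite (ltnW kp : (k < p.+1)%N).
- split=> [|j]; first exact: leq_maxl.
  rewrite !fctE YE ?ltn_eqF// !fctE /lead eqxx /cut (leqW (ltnSn p)) opprD addrA -/(u j).
  rewrite /v; case: leqP => jJ'; first by rewrite subrr eqxx.
  rewrite subr0 => uj; rewrite andbT leqNgt; apply: contra uj => jJ.
  by rewrite /u /y leqNgt jJ subr0 x_head.
Qed.

End Blocks.

(** * No seminorm dominates on an infinite-dimensional subspace *)

Section NoBanach.
Variable R : realType.
Local Notation arr := (nat -> nat -> R^o).
Implicit Types (x y z : arr) (S : set arr) (p n J : nat).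

Lemma cut_lead p z : (forall j k, (k < p)%N -> z j k = 0) ->
  cut p.+1 z = lead p (fun j => z j p).
Proof.
move=> z0; apply/funext => j; apply/funext => k; rewrite /cut /lead ltnS.
by case: ltngtP => // kp; [rewrite z0|rewrite kp].
Qed.

Lemma sum_leads p N (e : nat -> R) (u : nat -> nat -> R) :
  \sum_(a < N) e a *: lead p (u a) = lead p (fun j => \sum_(a < N) e a * u a j).
Proof.
apply/funext => j; apply/funext => k; rewrite !fct_sumE {2}/lead.
case: eqP => [->|/eqP/negbTE kp]; last by rewrite big1// => a _; rewrite !fctE /lead kp scaler0.
by apply: eq_bigr => a _; rewrite !fctE /lead eqxx.
Qed.

Lemma disjoint_sqr_sum N (e : nat -> R) (u : nat -> R) : signs e ->
  (forall a b, a != b -> u a = 0 \/ u b = 0) ->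
  (\sum_(a < N) e a * u a) ^+ 2 <= \sum_(a < N) u a ^+ 2.
Proof.
move=> es ud; elim: N => [|N IH]; first by rewrite !big_ord0 expr0n.
rewrite !big_ord_recr/=; have [uN|uN] := eqVneq (u N) 0.
  by rewrite uN mulr0 addr0 expr0n addr0.
rewrite big1 ?add0r => [|a _]; last first.
  have [//|->|/eqP] := ud a N; rewrite ?mulr0 ?(negbTE uN)//.
  by rewrite ltn_eqF.
by rewrite exprMn (signs_sqr N es) mul1r lerDr sumr_ge0// => a _; rewrite sqr_ge0.
Qed.

(** The single seminorm [n] then defines the topology of [S], as it would on a Banach subspace. *)
Definition dominated S n :=
  forall m, exists C : R, forall x, S x -> seminorm m x <= C * seminorm n x.

(** In F_(p+1) the blocks are almost orthogonal in l_2, so signed sums of [4 ^ L] of them are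
    O([2 ^ L]); domination carries this to F_(p+2), where [disjoint_sum_bound] makes some leading
    column too small for large [L]. *)
Lemma blocks_not_dominated S p : lin_subspace S -> (forall x, S x -> in_tower x) ->
  (forall J (e : R), 0 < e -> exists x J' z,
    [/\ S x, seminorm p.+1 x = 1, inball p.+2 e (cut p.+2 x - z),
      forall j k, (k < p)%N -> z j k = 0 &
      (J <= J')%N /\ forall j, z j p != 0 -> (J <= j < J')%N]) ->
  ~ dominated S p.+1.
Proof.
move=> Ssub St step /(_ p.+2)[C0 C0P].
pose C := Num.max C0 1.
have C1 : 1 <= C by rewrite le_max lexx orbT.
have CP x : S x -> seminorm p.+2 x <= C * seminorm p.+1 x.
  by move=> /C0P/le_trans; apply; rewrite ler_wpM2r ?seminorm_ge0// le_max lexx.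
pose c2 : R := 2 ^+ p.+1 * 5.
have c20 : 0 < c2 by rewrite mulr_gt0 ?exprn_gt0.
pose K := C * (23 * c2 + 1) + 1; have K0 : 0 < K by rewrite /K; nra.
have CK : C + 1 <= K by rewrite /K; nra.
(* Here [c2 * d = 1/4]: a leading column of l_2 norm at most [d], with a perturbation of size at
   most 1/2, cannot reach seminorm 1. *)
pose d := (4 * c2)^-1; have d0 : 0 < d by rewrite invr_gt0 mulr_gt0.
(* [54 ^ 2] exceeds the constant 2816 of [disjoint_sum_bound]. *)
pose L := Num.bound (54 * K / d).
have LP : 54 * K / d < L%:R by apply: archi_boundP; rewrite divr_ge0 ?mulr_ge0 ?(ltW K0) ?(ltW d0).
(* The perturbations of all [N] blocks together have size at most 1/2. *)
pose N := (4 ^ L)%N; pose e : R := wt R (L * 2).+1.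
have Ne : N%:R * e = 2^-1.
  have -> : N%:R = 2 ^+ (L * 2) :> R by rewrite /N natrX mulnC exprM; congr (_ ^+ L); ring.
  by have := wtV R (L * 2); rewrite (wtS R (L * 2)) -/e; lra.
have e0 : 0 < e by exact: wt_gt0.
have e12 : e <= 2^-1 by rewrite -Ne ler_peMl ?(ltW e0)// ler1n expn_gt0.
have H J : exists xJz : arr * nat * arr, [/\ S xJz.1.1, seminorm p.+1 xJz.1.1 = 1,
    inball p.+2 e (cut p.+2 xJz.1.1 - xJz.2),
    forall j k, (k < p)%N -> xJz.2 j k = 0 &
    (J <= xJz.1.2)%N /\ forall j, xJz.2 j p != 0 -> (J <= j < xJz.1.2)%N].
  by have [x [J' [z H]]] := step J e e0; exists (x, J', z).
have {H}[f fP] := choice H.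
(* Each block starts no earlier than the row where the previous one ended, which makes the leading
   columns disjoint. *)
pose Jn a := iter a (fun J => (f J).1.2) 0%N.
pose x a := (f (Jn a)).1.1; pose z a := (f (Jn a)).2.
have Sx a : S (x a) by case: (fP (Jn a)).
have xt a : in_tower (x a) := St _ (Sx a).
have x1 a : seminorm p.+1 (x a) = 1 by case: (fP (Jn a)).
pose y a : arr := cut p.+2 (x a) - z a.
have yb a : inball p.+2 e (y a) by case: (fP (Jn a)).
have z0 a j k : (k < p)%N -> z a j k = 0 by case: (fP (Jn a)) => _ _ _ + _; apply.
have zsupp a j : z a j p != 0 -> (Jn a <= j < Jn a.+1)%N by case: (fP (Jn a)) => _ _ _ _ [_]; apply.
have JnS a : (Jn a <= Jn a.+1)%N by case: (fP (Jn a)) => _ _ _ _ [].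
have Jn_mono a b : (a <= b)%N -> (Jn a <= Jn b)%N.
  by move=> /subnKC <-; elim: (b - a)%N => [|i IH]; rewrite ?addn0// addnS (leq_trans IH).
have zdisj a b j : a != b -> z a j p = 0 \/ z b j p = 0.
  move=> ab; have [->|/zsupp/andP[a1 a2]] := eqVneq (z a j p) 0; first by left.
  right; apply/eqP; apply: contraT => /zsupp/andP[b1 b2].
  move: ab; rewrite neq_ltn => /orP[ab|ba].
    by have := leq_trans a2 (Jn_mono _ _ ab); rewrite ltnNge b1.
  by have := leq_trans b2 (Jn_mono _ _ ba); rewrite ltnNge a1.
pose u a j : R := z a j p.
have zE a : z a = cut p.+2 (x a) - y a by rewrite /y opprB addrCA subrr addr0.
have yb1 a : inball p.+1 e (cut p.+1 (y a)) := inball_cut (yb a).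
have leadE a : lead p (u a) = cut p.+1 (x a) - cut p.+1 (y a).
  by rewrite -(cut_lead (z0 a)) zE cutB cut_cut.
have xb1 a : inball p.+1 1 (cut p.+1 (x a)) by rewrite -(x1 a); exact: seminorm_inball.
have lead_b a : inball p.+1 2 (lead p (u a)).
  rewrite leadE; apply: inball_le (inballB (xb1 a) (yb1 a)).
  by rewrite (natrD _ 1 1) lerD2l (le_trans e12)// invf_le1// ler1n.
have ub a J : \sum_(j < J) u a j ^+ 2 <= 512.
  have := @inball_lead_coord R p 2 (lead p (u a)) J (ltr0Sn _ 1) (lead_b a).
  under eq_bigr do rewrite /lead eqxx; move=> /(_ _)/le_trans; apply.
    by move=> j k kp; rewrite /lead ltn_eqF.
  by rewrite -natrX -natrM.
have ulow a J : (Jn a.+1 <= J)%N -> d ^+ 2 < \sum_(j < J) u a j ^+ 2.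
  move=> aJ; rewrite ltNge; apply/negP => small.
  have us J0 : \sum_(j < J0) u a j ^+ 2 <= d ^+ 2.
    apply: le_trans small; have [J0J|JJ0] := leqP J0 J.
      rewrite (big_ord_widen J (fun j => u a j ^+ 2) J0J) big_mkcond/=.
      by apply: ler_sum => j _; case: ifP => // _; rewrite sqr_ge0.
    rewrite (big_ord_widen J0 (fun j => u a j ^+ 2) (ltnW JJ0)) [leRHS]big_mkcond/=.
    apply: ler_sum => j _; case: ltnP => // Jj.
    have [->|/zsupp/andP[_ jJ]] := eqVneq (u a j) 0; first by rewrite expr0n.
    by have := leq_trans jJ (leq_trans aJ Jj); rewrite ltnn.
  have /(inball_lead p d0) := us; rewrite -mulrA (mulrC d) mulrA -/c2 => lb.
  have := inballD lb (yb1 a); rewrite leadE subrK => /gauge_le.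
  rewrite -/(seminorm p.+1 (x a)) x1 /d invfM mulrCA mulfV ?gt_eqF// mulr1; move: e12; lra.
have zK a : inball p.+2 K (z a).
  rewrite zE; apply: inball_le (inballB (seminorm_inball p.+2 (xt a)) (yb a)).
  have := CP _ (Sx a); rewrite x1; move: e12 CK; lra.
have zsum s : signs s -> inball p.+2 (K * 2 ^+ L) (\sum_(a < 4 ^ L) s a *: z a).
  move=> ss; rewrite -/N; set X := \sum_(a < N) s a *: x a.
  have SX : S X by exact: (@lin_subspace_sum R arr S _ (fun a : 'I_N => s a) (fun a : 'I_N => x a)).
  have -> : \sum_(a < N) s a *: z a = cut p.+2 X - \sum_(a < N) s a *: y a.
    rewrite /X cut_sum -sumrB; apply: eq_bigr => a _.
    by rewrite -scalerBr -zE.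
  have X1 : seminorm p.+1 X <= 23 * c2 * 2 ^+ L + 1.
    have XE : cut p.+1 X = lead p (fun j => \sum_(a < N) s a * u a j) +
        \sum_(a < N) s a *: cut p.+1 (y a).
      rewrite -sum_leads /X cut_sum -big_split/=; apply: eq_bigr => a _.
      by rewrite leadE -scalerDr subrK.
    rewrite /seminorm; apply: gauge_le; rewrite XE.
    (* Disjointness makes squares add, each block contributes at most 512, and [512 <= 23 ^ 2]. *)
    have lb : inball p.+1 (2 ^+ p.+1 * (23 * 2 ^+ L) * 5) (lead p (fun j => \sum_(a < N) s a * u a j)).
      apply: inball_lead => [|J]; first by rewrite mulr_gt0// exprn_gt0.
      apply: (@le_trans _ _ (\sum_(j < J) \sum_(a < N) u a j ^+ 2)).
        by apply: ler_sum => j _; apply: (@disjoint_sqr_sum N s (u^~ j) ss) => a b; exact: zdisj.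
      rewrite exchange_big/= (@le_trans _ _ (\sum_(a < N) 512))//.
        by apply: ler_sum => a _; exact: ub.
      rewrite sumr_const card_ord -[_ *+ N]mulr_natl.
      have -> : N%:R = (2 ^+ L) ^+ 2 :> R by rewrite /N natrX -exprM mulnC exprM; congr (_ ^+ L); ring.
      by rewrite exprMn mulrC ler_wpM2r ?exprn_ge0// -natrX ler_nat.
    have := inballD lb (inball_sum N ss yb1); rewrite Ne; apply: inball_le.
    rewrite /c2; lra.
  apply: inball_le (inballB (seminorm_inball p.+2 (St _ SX)) (inball_sum N ss yb)).
  have := CP _ SX; rewrite Ne => CX.
  have L1 : 1 <= 2 ^+ L :> R by rewrite exprn_ege1// ler1n.
  have C0' : 0 <= C by rewrite (le_trans _ C1).
  have := ler_wpM2l C0' X1; have := ler_wpM2l C0' L1; rewrite /K; lra.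
have [a aN] := disjoint_sum_bound (Jn N) K0 z0 zdisj zK zsum.
apply/negP; rewrite -ltNge.
have uN : d ^+ 2 < \sum_(j < Jn N) u a j ^+ 2 by apply: ulow; exact: Jn_mono.
apply: (@lt_le_trans _ _ (L%:R ^+ 2 * d ^+ 2)); last first.
  by rewrite ler_wpM2l ?exprn_ge0// ltW.
rewrite ltr_pdivrMr// in LP.
rewrite -exprMn; apply: (@le_lt_trans _ _ ((54 * K) ^+ 2)).
  by rewrite exprMn ler_wpM2r ?exprn_ge0 ?(ltW K0)// -natrX ler_nat.
by rewrite ltr_pXn2r// nnegrE ?mulr_ge0 ?(ltW K0) ?(ltW d0).
Qed.

(** Induction on [n]; seminorm 0 is zero, so it dominates only the zero subspace. If seminorm [p]
    controlled seminorm [p.+1] on an infinite-dimensional subspace, it would dominate there, against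
    the induction hypothesis; otherwise [block_step] supplies blocks. *)
Theorem not_dominated n S : lin_subspace S -> (forall x, S x -> in_tower x) ->
  infinite_dim S -> ~ dominated S n.
Proof.
elim: n S => [|p IH] S Ssub St Sinf Sdom.
  have [x Sx /eqP] := infinite_dim_nonzero Sinf; apply.
  apply: seminorm_eq0 => [|m]; first exact: St.
  have [C /(_ x Sx)] := Sdom m; rewrite {2}/seminorm.
  have -> : cut 0 x = 0 by [].
  by rewrite gauge0 mulr0 => h; apply/le_anti; rewrite h seminorm_ge0.
apply: (blocks_not_dominated Ssub St _ Sdom); apply: block_step => // S' t S'S S'sub S'inf t0.
apply: contrapT => no; apply: (IH S') => //; first by move=> x /S'S; exact: St.
move=> m; have [C CP] := Sdom m; exists (Num.max C 0 / t) => x S'x.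
apply: (le_trans (CP _ (S'S _ S'x))).
apply: (@le_trans _ _ (Num.max C 0 * seminorm p.+1 x)).
  by rewrite ler_wpM2r ?seminorm_ge0// le_max lexx.
rewrite -mulrA ler_wpM2l ?le_max ?lexx ?orbT// mulrC ler_pdivlMr// mulrC leNgt.
by apply/negP => lt; apply: no; exists x.
Qed.

End NoBanach.

(** * Absence of Banach subspaces and of a product decomposition *)

Section Twisted.
Variable R : realType.
Local Notation arr := (nat -> nat -> R^o).
Local Notation tower := (tower R).

Lemma homogeneous_bound (U : lmodType R) (f g : U -> R) (d e : R) :
  0 < d -> 0 < e ->
  (forall a x, f (a *: x) = `|a| * f x) -> (forall a x, g (a *: x) = `|a| * g x) ->
  (forall x, 0 <= f x) ->
  (forall x, f x < d -> g x < e) -> forall x, g x <= e / d * f x.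
Proof.
move=> d0 e0 fZ gZ f0 fg x; apply/ler_addgt0Pr => t t0.
(* The summand [t / e] keeps [r] positive, also when [f x = 0], and costs [t] in the conclusion. *)
pose r := f x / d + t / e.
have r0 : 0 < r by rewrite ltr_wpDl ?divr_ge0 ?divr_gt0 ?(ltW d0).
have /fg : f (r^-1 *: x) < d.
  rewrite fZ ger0_norm ?invr_ge0 ?(ltW r0)// mulrC ltr_pdivrMr// /r mulrDr.
  by rewrite mulrCA mulfV ?gt_eqF// mulr1 ltrDl mulr_gt0// divr_gt0.
rewrite gZ ger0_norm ?invr_ge0 ?(ltW r0)// mulrC ltr_pdivrMr// => /ltW/le_trans; apply.
rewrite /r mulrDr le_eqVlt; apply/orP; left; apply/eqP; field.
by rewrite !gt_eqF.
Qed.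

Lemma continuous_nbhs0 (B : completeNormedModType R) (F : tvsType R)
    (T : {linear B -> F}) (U : set F) : continuous T -> nbhs 0 U ->
  exists2 d : R, 0 < d & forall b, `|b| < d -> U (T b).
Proof.
move=> Tcont U0; have : nbhs (0 : B) (T @^-1` U) by apply: Tcont; rewrite linear0.
by move=> /nbhs_norm0P[d /= d0 dU]; exists d.
Qed.

(** Openness of the embedding bounds the Banach norm by some seminorm [n], and continuity bounds
    every seminorm by the Banach norm, so seminorm [n] would dominate. *)
Lemma tower_no_banach_subspace : ~ @has_inf_dim_banach_subspace R tower.
Proof.
move=> [S [Ssub _ Sinf [B [T [_ TS Tcont Topen]]]]].
have [W [[n [e [e0 nW]]] WU]] := Topen _ (nbhsx_ballx (0 : B) 1 ltr01).
have bn (b : B) : `|b| <= 1 / e * tnorm n (T b).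
  apply: (@homogeneous_bound B (fun b => tnorm n (T b)) Num.norm) => //.
  - by move=> a x; rewrite linearZ/= tnormZ.
  - by move=> a x; exact: normrZ.
  - by move=> x; exact: tnorm_ge0.
  - move=> x xe; have := WU x; rewrite -ball_normE/= sub0r normrN; apply.
    by apply: nW; rewrite /tball/= subr0.
pose S' : set arr := [set val x | x in S].
have S'sub : lin_subspace S'.
  have [S0 SD SZ] := Ssub; split.
  - by exists 0; rewrite ?raddf0.
  - by move=> _ _ [x Sx <-] [y Sy <-]; exists (x + y); [exact: SD|rewrite raddfD].
  - by move=> a _ [x Sx <-]; exists (a *: x); [exact: SZ|rewrite linearZ].
have S'inf : infinite_dim S'.
  move=> m; have [v [Sv vfree]] := Sinf m; exists (fun i => val (v i)); split=> [i|c c0].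
    by exists (v i).
  apply: vfree; apply: val_inj; rewrite raddf0 -[RHS]c0 raddf_sum.
  by apply: eq_bigr => i _; rewrite -linearZ.
apply: (@not_dominated R n S' S'sub _ S'inf) => [_ [x _ <-]|m]; first exact: towerP.
have [|d d0 dT] := continuous_nbhs0 Tcont (_ : nbhs (0 : tower) (tball 0 m 1)).
  by apply: tball_nbhs; exact: tball_center.
exists (1 / d * (1 / e)) => _ [x Sx <-].
have [b _ <-] : (T @` setT) x by rewrite TS.
rewrite -/(tnorm m (T b)) -/(tnorm n (T b)).
apply: (@le_trans _ _ (1 / d * `|b|)); last first.
  by rewrite -[leRHS]mulrA ler_wpM2l ?bn// divr_ge0// ltW.
apply: (@homogeneous_bound B Num.norm (fun b => tnorm m (T b))) => //.
- by move=> a y; exact: normrZ.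
- by move=> a y; rewrite linearZ/= tnormZ.
- by move=> y /dT; rewrite /tball/= subr0.
Qed.

Lemma linear_of (U V : lmodType R) (f : U -> V) : linear f ->
  exists g : {linear U -> V}, g =1 f.
Proof.
move=> lf; pose g : {linear U -> V} := HB.pack f (GRing.isLinear.Build R U V *:%R f lf).
by exists g.
Qed.

(** The factor [B i] embeds as the closed subspace where all other coordinates vanish, so it cannot
    be infinite-dimensional. The conclusion has the form required by [infinite_dim_sub]. *)
Lemma factor_finite_dim (F : tvsType R) (I : countType) (B : I -> completeNormedModType R)
    (Q : forall i, {linear F -> B i}) i :
  ~ has_inf_dim_banach_subspace F ->
  (forall i, continuous (Q i)) ->
  (forall x y, (forall i, Q i x = Q i y) -> x = y) ->
  (forall y : forall i, B i, exists x, forall i, Q i x = y i) ->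
  (forall U : set F, nbhs (0 : F) U ->
    exists (s : seq I) (V : forall i, set (B i)),
      (forall i, i \in s -> nbhs (0 : B i) (V i)) /\
      (forall x, (forall i, i \in s -> V i (Q i x)) -> U x)) ->
  exists r, forall v : 'I_r -> F, exists c : 'I_r -> R,
    (exists a, c a != 0) /\ Q i (\sum_a c a *: v a) = 0.
Proof.
move=> nob Qcont Qinj Qsurj Qtop.
pose S : set F := [set x | forall j, j != i -> Q j x = 0].
have T0 (b : B i) : exists x, forall j, Q j x = dfwith (fun k => 0 : B k) i b j.
  exact: Qsurj.
have {T0}[f fP] := choice T0.
have fi b : Q i (f b) = b by rewrite fP dfwithin.
have fj b j : j != i -> Q j (f b) = 0 by move=> ji; rewrite fP dfwithout// eq_sym.
have flin : linear f.
  move=> a x y; apply: Qinj => j; rewrite linearP.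
  have [->|ji] := eqVneq j i; first by rewrite !fi.
  by rewrite !fj// scaler0 addr0.
have [T TE] := linear_of flin.
have nS : ~ infinite_dim S.
  move=> Sinf; apply: nob; exists S; split=> //.
  - split=> [j _|x y Sx Sy j ji|a x Sx j ji]; first exact: linear0.
      by rewrite linearD/= Sx// Sy// addr0.
    by rewrite linearZ/= Sx// scaler0.
  - have -> : S = \bigcap_(j in [set j | j != i]) (Q j @^-1` [set 0]).
      by apply/seteqP; split=> x /=.
    apply: closed_bigI => j _; apply: preimage_closed; first by move=> x _; exact: Qcont.
    exact/accessible_closed_set1/hausdorff_accessible/norm_hausdorff.
  - exists (B i), T; split.
    + by move=> x y; rewrite !TE => /(congr1 (Q i)); rewrite !fi.
    + apply/seteqP; split=> [_ [b _ <-] j ji|x Sx]; first by rewrite TE fj.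
      exists (Q i x) => //; rewrite TE; apply: Qinj => j.
      by have [->|ji] := eqVneq j i; [rewrite fi|rewrite fj// Sx].
    + have T00 U : nbhs (0 : F) U -> nbhs (0 : B i) (T @^-1` U).
        move=> /Qtop[s [V [V0 VU]]].
        have [si|si] := boolP (i \in s); last first.
          apply: filterS filterT => b _; apply: VU => j js.
          rewrite /= TE fj; first by have := nbhs_singleton (V0 j js).
          by apply: contraNneq si => <-.
        apply: filterS (V0 i si) => b Vb; apply: VU => j js; rewrite TE.
        have [->|ji] := eqVneq j i; first by rewrite fi.
        by rewrite fj//; exact: nbhs_singleton (V0 j js).
      (* Continuity at 0 is carried to [x] by translation. *)
      move=> x U /(@nbhsB _ _ _ _ (- T x)); rewrite addNr => /T00 /(@nbhsT _ _ _ x).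
      change (nbhs x ( +%R x @` (T @^-1` ( +%R (- T x) @` U))) -> nbhs x (T @^-1` U)).
      by apply: filterS => _ [b [u Uu ub] <-]; rewrite /= linearD/= -ub addrA subrr add0r.
    + move=> U U0; exists (Q i @^-1` U); split; last by move=> b; rewrite /= TE fi.
      by apply: Qcont; rewrite linear0.
have [r nr] : exists r, ~ exists v : 'I_r -> F, (forall a, S (v a)) /\
    (forall c : 'I_r -> R, \sum_a c a *: v a = 0 -> forall a, c a = 0).
  by apply: contra_notP nS => /forallNP H r; apply: contrapT; exact: H.
exists r => v; apply: contrapT => nc; apply: nr.
exists (fun a => T (Q i (v a))); split=> [a j ji|c c0 a]; first by rewrite TE fj.
apply/eqP; apply: contraT => ca; exfalso; apply: nc; exists c; split; first by exists a.
rewrite linear_sum; under eq_bigr do rewrite linearZ/= -[Q i (v _)]fi -TE.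
by rewrite -[RHS](linear0 (Q i)) -c0 linear_sum; apply: eq_bigr => b _; rewrite linearZ.
Qed.

Definition unit_row j : arr := lead 0 (fun i => (i == j)%:R : R).

Lemma in_tower_unit_row j : in_tower (unit_row j).
Proof.
case=> [|n]; first by have -> : cut 0 (unit_row j) = 0 by []; exact: bounded_arr0.
have -> : cut n.+1 (unit_row j) = unit_row j.
  apply/funext => i; apply/funext => k; rewrite /cut; case: ltnP => // nk.
  by rewrite /unit_row /lead gtn_eqF// (leq_trans _ nk).
exists (2 ^+ n.+1 * 1 * 2).
apply: (@scales_inball _ _ _ _ _ (fun i => if i == j then 0%N else i.+1)) => //.
- by rewrite ler1n.
- by move=> i k nk; rewrite /unit_row /lead gtn_eqF// (leq_trans _ nk).
- move=> i k _; case: eqP => [->|/eqP/negbTE ij].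
    rewrite /unit_row /lead/= eqxx /wt expr0 mul1r.
    by case: (k == 0%N); rewrite ?normr1 ?normr0.
  rewrite shiftn0 => [|l]; first by rewrite normr0 mul1r wt_ge0.
  by rewrite /unit_row /lead ij; case: (l == 0%N).
- move=> J; apply: (@le_trans _ _ (\sum_(i < J) ((i == j :> nat)%:R + wt R i.+1))).
    apply: ler_sum => i _; case: eqP => _.
      by rewrite /wt expr0 expr1n lerDl -/(wt R i.+1) wt_ge0.
    by rewrite add0r wt_sqr_le.
  rewrite big_split/= (natrD _ 1 1) lerD ?sum_wtS//.
  rewrite -natr_sum ler_nat; have [jJ|Jj] := ltnP j J.
    rewrite (bigD1 (Ordinal jJ))//= eqxx big1// => i ij.
    by apply/eqP; rewrite eqb0; apply: contraNneq ij => e; apply/eqP/val_inj.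
  by rewrite big1// => i _; apply/eqP; rewrite eqb0 ltn_eqF// (leq_trans (ltn_ord i)).
Qed.

(** On this subspace seminorm 1 is already a norm. *)
Definition first_coord : set tower := [set x | forall j k, (0 < k)%N -> val x j k = 0].

Lemma lin_subspace_first_coord : lin_subspace first_coord.
Proof.
split=> [j k _|x y x0 y0 j k k0|a x x0 j k k0]; first by rewrite raddf0.
  rewrite raddfD; change (val x j k + val y j k = 0).
  by rewrite x0// y0// addr0.
by rewrite linearZ; change (a *: val x j k = 0); rewrite x0// scaler0.
Qed.

Lemma infinite_dim_first_coord : infinite_dim first_coord.
Proof.
move=> n; exists (fun i : 'I_n => to_tower (in_tower_unit_row i)); split=> [i j k k0|c c0 i].
  by rewrite /= /unit_row /lead gtn_eqF.
have : \sum_a c a *: unit_row a = 0.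
  have /(congr1 val) := c0; rewrite raddf0 raddf_sum => e; rewrite -[RHS]e.
  exact: eq_bigr.
move=> /(congr1 (fun f : arr => f i 0%N)); rewrite !fct_sumE (bigD1 i)//= big1 => [|a ai].
  by rewrite !fctE /unit_row /lead !eqxx addr0 => /eqP; rewrite scaler_eq0 oner_eq0 orbF => /eqP.
rewrite !fctE /unit_row /lead eqxx; suff -> : (i == a :> nat) = false by rewrite scaler0.
by apply/negbTE; rewrite eq_sym.
Qed.

(** In a product the unit ball of seminorm 1 would contain the common kernel of finitely many factor
    maps. Finite-dimensional factors let this kernel meet [first_coord] in infinite dimension; a
    line in the intersection stays in the ball, so seminorm 1 vanishes on it, which is
    impossible. *)
Lemma tower_not_product : ~ @iso_countable_product R tower.
Proof.
move=> [I [B [Q [Qcont Qinj Qsurj Qtop]]]].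
have fin i := factor_finite_dim i tower_no_banach_subspace Qcont Qinj Qsurj Qtop.
have [|s [V [V0 VU]]] := Qtop (tball 0 1 1).
  by apply: tball_nbhs; exact: tball_center.
pose K (t : seq I) : set tower := first_coord `&` [set x | forall i, i \in t -> Q i x = 0].
have Ksub t : lin_subspace (K t).
  have [F0 FD FZ] := lin_subspace_first_coord; split.
  - by split=> // i _; exact: linear0.
  - move=> x y [Fx x0] [Fy y0]; split; first exact: FD.
    by move=> i it; rewrite linearD/= x0// y0// addr0.
  - move=> a x [Fx x0]; split; first exact: FZ.
    by move=> i it; rewrite linearZ/= x0// scaler0.
have Kinf t : infinite_dim (K t).
  elim: t => [|i t IH].
    have -> : K [::] = first_coord by apply/seteqP; split=> [x []|x].
    exact: infinite_dim_first_coord.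
  have -> : K (i :: t) = K t `&` [set x | Q i x = 0].
    apply/seteqP; split=> [x [Fx x0]|x [[Fx x0] xi]]; last first.
      by split=> // j; rewrite inE => /predU1P[->|/x0].
    split; last by apply: x0; exact: mem_head.
    by split=> // j jt; apply: x0; rewrite inE jt orbT.
  have [r rP] := fin i; apply: (@infinite_dim_sub _ _ _ _ r) => // v _; exact: rP.
have [x [Fx xs] /eqP] := infinite_dim_nonzero (Kinf s); apply.
have xsmall (a : R) : tnorm 1 (a *: x) < 1.
  rewrite -[a *: x]subr0; apply: VU => i si; rewrite linearZ/= xs// scaler0.
  exact: nbhs_singleton (V0 i si).
have x0 : tnorm 1 x = 0.
  apply/eqP; apply: contraT => nx; have := xsmall (tnorm 1 x)^-1.
  by rewrite tnormZ normfV ger0_norm ?tnorm_ge0// mulVf// ltxx.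
apply: val_inj; rewrite raddf0; apply/funext => j; apply/funext => -[|k]; last exact: Fx.
have /(congr1 (fun f : arr => f j 0%N)) := gauge0_eq0 (towerP x 1) x0.
by [].
Qed.

End Twisted.

Theorem mainTheorem1 (R : realType) :
  exists F : tvsType R,
    twisted_quojection F /\
    ~ has_inf_dim_banach_subspace F.
Proof.
exists (tower R); split; last exact: tower_no_banach_subspace.
by split; [exact: tower_quojection|exact: tower_not_product].
Qed.
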